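(* Let $n \geq 2$ be an integer. Then $\alpha_n$ (the reciprocal of the $n$-dimensional integrality gap of the maximum-cut semidefinite programming relaxation, defined in the context) equals the optimal value of the optimization problem $$\sup\bigl\{\, \alpha \in \mathbb{R} : 1 - K(t) \geq \alpha(1-t) \text{ for all } t \in [-1,1],\ K \in \mathrm{CUT}_\square(S^{n-1}) \text{ is invariant}\,\bigr\},$$ where the supremum is over all pairs $(K,\alpha)$ satisfying the constraints.
   Context: For $x,y\in\mathbb{R}^n$, $x\cdot y$ is the Euclidean inner product, and $S^{n-1}=\{x\in\mathbb{R}^n : x\cdot x=1\}$. Integrality gap. For a nonempty finite set $V$, a matrix $A\in\mathbb{R}^{V\times V}$ with nonnegative entries and an integer $n\ge 1$, let $$\mathrm{SDP}_n(A)=\max\Bigl\{\sum_{x,y\in V}A(x,y)\bigl(1-f(x)\cdot f(y)\bigr) : f\colon V\to S^{n-1}\Bigr\}.$$ In particular, for $n=1$, $S^0=\{-1,1\}$. Put $\gamma_n=\sup\{\mathrm{SDP}_n(A)/\mathrm{SDP}_1(A)\}$, where the supremum is over all finite nonempty $V$ and all entrywise nonnegative matrices $A\in\mathbb{R}^{V\times V}$ with $\mathrm{SDP}_1(A)\neq 0$, and $\alpha_n=\gamma_n^{-1}$. Cut polytope. For a finite nonempty set $U$, $\mathrm{CUT}_\square(U)\subseteq\mathbb{R}^{U\times U}$ is the convex hull of the matrices $f\otimes f^*$, $f\colon U\to\{-1,1\}$, where $(f\otimes f^* )(x,y)=f(x)f(y)$. Let $C(S^{n-1}\times S^{n-1})$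 be the set of continuous real-valued functions (continuous kernels) on $S^{n-1}\times S^{n-1}$. Then $\mathrm{CUT}_\square(S^{n-1})$ is the set of all $K\in C(S^{n-1}\times S^{n-1})$ such that $(K(x,y))_{x,y\in U}\in\mathrm{CUT}_\square(U)$ for every finite nonempty $U\subseteq S^{n-1}$. Invariance. A kernel $K\colon S^{n-1}\times S^{n-1}\to\mathbb{R}$ is invariant if $K(Tx,Ty)=K(x,y)$ for all $T$ in the group $\mathrm{O}(n)$ of $n\times n$ orthogonal matrices and all $x,y\in S^{n-1}$. In that case $K(x,y)$ depends only on $x\cdot y$, and for $t\in[-1,1]$ one writes $K(t)$ for the common value of $K$ on pairs $(x,y)$ with $x\cdot y=t$. *)

(* Defs.v *)
From HB Require Import structures.
From mathcomp Require Import all_boot all_order all_algebra finmap.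
From mathcomp Require Import boolp classical_sets functions reals ereal.
From mathcomp Require Import topology normedtype convex.

Set Implicit Arguments.
Unset Strict Implicit.
Unset Printing Implicit Defensive.

Import Order.TTheory GRing.Theory Num.Theory.
Import numFieldNormedType.Exports.

Local Open Scope classical_set_scope.
Local Open Scope ring_scope.

Section MaxCutGap.
Variable R : realType.

Definition dot (n : nat) (x y : 'cV[R]_n) : R := \sum_(i < n) x i 0 * y i 0.

Definition sphere (n : nat) : set 'cV[R]_n := [set x | dot x x = 1].

(* For n >= 1 the set of objective values is nonempty and compact, so that this
   supremum is the maximum. *)
Definition SDP (n : nat) (V : finType) (A : V -> V -> R) : R :=
  sup [set s | exists f : V -> 'cV[R]_n,
         (forall x, sphere (f x)) /\
         s = \sum_x \sum_y A x y * (1 - dot (f x) (f y))].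

(* Taken in the extended reals, so that no boundedness is presupposed. *)
Definition gamma (n : nat) : \bar R :=
  ereal_sup [set r | exists (V : finType) (A : V -> V -> R),
    [/\ (0 < #|V|)%N, forall x y, 0 <= A x y, SDP 1 A != 0
      & r = (SDP n A / SDP 1 A)%:E]].

Definition alpha (n : nat) : \bar R := ((gamma n)^-1)%E.

Definition convex_hull (E : lmodType R) (S : set E) : set E :=
  smallest (@convex_set R E) S.

Definition cut_polytope (U : finType) : set (U -> U -> R^o) :=
  convex_hull [set M | exists f : U -> R,
    (forall x, f x = 1 \/ f x = -1) /\ M = fun x y => f x * f y].

(* A kernel on the sphere is represented by a function on pairs of vectors,
   only its values at points of the sphere being constrained or used. *)
Definition cut_sphere (n : nat) : set ('cV[R]_n -> 'cV[R]_n -> R) :=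
  [set K | {within @sphere n `*` @sphere n, continuous (fun p => K p.1 p.2)} /\
    forall U : {fset 'cV[R]_n}, U != fset0 ->
      [set` U] `<=` @sphere n ->
      @cut_polytope U (fun x y => K (val x) (val y))].

Definition orthogonal_mx (n : nat) (T : 'M[R]_n) : Prop := T^T *m T = 1%:M.

Definition invariant_kernel (n : nat) (K : 'cV[R]_n -> 'cV[R]_n -> R) : Prop :=
  forall T, orthogonal_mx T ->
  forall x y, sphere x -> sphere y -> K (T *m x) (T *m y) = K x y.

(* For K invariant, n >= 2 and t in [-1, 1], the set is a singleton. *)
Definition kernel_at (n : nat) (K : 'cV[R]_n -> 'cV[R]_n -> R) (t : R) : R :=
  get [set v | exists x y,
    [/\ sphere x, sphere y, dot x y = t & v = K x y]].

End MaxCutGap.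

(* Main.v *)
Require Import Defs.
From mathcomp Require Import all_boot all_order all_algebra finmap.
From mathcomp Require Import boolp classical_sets functions reals ereal.
From mathcomp Require Import topology normedtype convex.
From mathcomp Require Import perm lra ring.

(** The inequality between the two values that is easy is that a feasible
pair [(K, a)] bounds the gap: restricted to the vectors of a semidefinite
solution, [K] is a convex combination of cuts, whence
[a * SDP n A <= SDP 1 A] for every [A] ([feasible_gap]).

Conversely let [a < b] with [b >= 0] and [b * SDP n A <= SDP 1 A] for all [A]; a
feasible kernel for [a] is needed ([gap_feasible]). Linear programming duality
([matrix_alternative], [cut_dominates]) gives, for every finite set of points of
the sphere, a convex combination [K] of cuts with [1 - K(x,y) >= b (1 - x.y)].
Three things separate these finite solutions from a continuous invariant
kernel.

- Continuity. For points forming a fine net, each cut of the net is extended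
  to the sphere through a partition into cells of small diameter and tapered
  to 0 near the boundaries of the cells. The resulting Lipschitz function
  [g] with values in [-1, 1] yields the kernel [1 - |g(x) - g(y)|], which is
  in the cut polytope because it is the expectation of the cut kernel of
  [g >= tau] for a uniform threshold [tau] ([layer_cake]). The cells are carved
  out by balls with one of many radii, chosen so that every point is close to
  a boundary for few radii only; averaging over the radii keeps the inequality
  up to an arbitrarily small error ([rounded_kernel]).

- Invariance. Averaging a Lipschitz kernel over a finite net of the orthogonal
  group lowers its oscillation along orbits: down to an error that vanishes with
  the mesh, it shrinks by a factor that depends only on the net. Iterating gives a uniformly convergent sequence of averages whose
  limit is invariant ([invariant_kernel_exists]); the cut inequalities, the
  Lipschitz bound and the lower bound on [1 - K] are preserved.

- The error. The inequality now holds with [b] up to a constant error, hence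
  with [a] and no error for pairs at a definite distance. For invariant [K] the
  triangle inequality bounds [1 - K] at one angle from below by half its value
  at the doubled angle, while [1 - cos] at least doubles, and this carries the
  inequality to all smaller angles ([invariant_bound_doubling]).

Membership in the cut polytope is handled throughout in its dual form
[cut_kernel], by [cut_polytopeP]. *)

Set Implicit Arguments.
Unset Strict Implicit.
Unset Printing Implicit Defensive.

Import Order.TTheory GRing.Theory Num.Theory.
Import numFieldNormedType.Exports.

Local Open Scope classical_set_scope.
Local Open Scope ring_scope.

(** * Linear programming duality and the cut polytope *)

(** The elimination step of Fourier-Motzkin: strict lower and upper bounds on one
nonnegative unknown are compatible as soon as they are pairwise compatible. *)
Lemma exists_between (R : realFieldType) (lo up : seq R) :
  {in up, forall u, 0 < u} -> {in lo & up, forall l u, l < u} ->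
  exists s, [/\ 0 <= s, {in lo, forall l, l < s} & {in up, forall u, s < u}].
Proof.
move=> up0 loup.
pose L := \big[Num.max/0]_(l <- lo) l.
pose U := \big[Num.min/L + 1]_(u <- up) u.
have L0 : 0 <= L by exact: bigmax_ge_id.
have LU : L < U.
  rewrite /U big_seq; elim/big_ind: _ => [|x y Lx Ly|u uin].
  - by rewrite ltrDl.
  - by rewrite lt_min Lx Ly.
  - rewrite /L big_seq; elim/big_ind: _ => [|x y xu yu|l lin]; first exact: up0.
      by rewrite gt_max xu yu.
    exact: loup.
exists ((L + U) / 2); split; first by lra.
- move=> l lin; have : l <= L by exact: le_bigmax_seq.
  lra.
- move=> u uin; have : U <= u by exact: ge_bigmin_seq.
  lra.
Qed.

(** A theorem of the alternative, by Fourier-Motzkin elimination on the rows [r].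
The cone [C] is an arbitrary convex cone containing the generators [s]: to
eliminate the row [i0], [C] is replaced by its part with nonnegative
[i0]-coordinate, and [s] by generators of that part, so that no coefficients of
the generators need be recorded. *)
Lemma cone_alternative (R : realFieldType) (I : eqType) (r : seq I)
    (s : seq (I -> R)) (C : set (I -> R)) :
  uniq r -> (forall w, w \in s -> C w) ->
  (forall u v, C u -> C v -> C (fun i => u i + v i)) ->
  (forall k v, 0 < k -> C v -> C (fun i => k * v i)) ->
  (exists v, C v /\ {in r, forall i, 0 <= v i}) \/
  (exists A : I -> R, (forall i, 0 <= A i) /\
     {in s, forall w, \sum_(i <- r) A i * w i < 0}).
Proof.
elim: r s C => [|i0 r IH] s C /=.
  move=> _ sC _ _; case: s sC => [|w s] sC.
    by right; exists (fun=> 0).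
  by left; exists w; split => //; apply: sC; rewrite mem_head.
move=> /andP[i0r ur] sC CD CM.
pose pos := [seq u <- s | 0 < u i0].
pose neg := [seq w <- s | w i0 < 0].
pose comb (u w : I -> R) := fun i => u i0 * w i + (- w i0) * u i.
pose s' := [seq w <- s | 0 <= w i0] ++ [seq comb u w | u <- pos, w <- neg].
have [|u v [Cu u0] [Cv v0]|k v k0 [Cv v0]|[v [[Cv v0] vr]]|[A [A0 As]]] :=
    IH s' [set v | C v /\ 0 <= v i0] ur.
- move=> w; rewrite mem_cat => /orP[|/allpairsP[[u v] /= [+ + ->]]].
    by rewrite mem_filter => /andP[w0 /sC].
  rewrite !mem_filter => /andP[u0 /sC Cu] /andP[v0 /sC Cv]; split.
    by apply: CD; apply: CM; rewrite ?oppr_gt0.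
  by rewrite /comb; lra.
- by split; [exact: CD|exact: addr_ge0].
- by split; [exact: CM|rewrite mulr_ge0// ltW].
- by left; exists v; split => // i; rewrite inE => /predU1P[->//|/vr].
(* The weight [a] of the row [i0] must satisfy [a * w i0 < - S w] for every
generator [w]; the pairs in [comb] say that these bounds are compatible. *)
right; pose S w := \sum_(i <- r) A i * w i.
have S_nneg w : w \in s -> 0 <= w i0 -> S w < 0.
  by move=> ws w0; apply: As; rewrite mem_cat mem_filter w0 ws.
have [||a [a0 alo aup]] := @exists_between R
    [seq S w / - w i0 | w <- neg] [seq - S u / u i0 | u <- pos].
- move=> _ /mapP[u + ->]; rewrite mem_filter => /andP[u0 us].
  by rewrite divr_gt0 // oppr_gt0 S_nneg// ltW.
- move=> _ _ /mapP[w wneg ->] /mapP[u upos ->].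
  have : S (comb u w) < 0.
    by apply: As; rewrite mem_cat allpairs_f ?orbT.
  have -> : S (comb u w) = u i0 * S w + (- w i0) * S u.
    rewrite /S !mulr_sumr -big_split; apply: eq_bigr => i _ /=.
    by rewrite /comb; ring.
  move: wneg upos; rewrite !mem_filter => /andP[w0 _] /andP[u0 _] h.
  rewrite ltr_pdivrMr ?oppr_gt0// mulrAC ltr_pdivlMr//.
  by lra.
exists (fun i => if i == i0 then a else A i); split.
  by move=> i; case: ifP.
move=> w ws; rewrite big_cons eqxx.
have -> : \sum_(j <- r) (if j == i0 then a else A j) * w j = S w.
  apply: eq_big_seq => i ir; case: eqVneq => // ii0.
  by rewrite ii0 (negbTE i0r) in ir.
case: (ltgtP (w i0) 0) => w0.
- have /alo : S w / - w i0 \in [seq S w / - w i0 | w <- neg].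
    by apply: map_f; rewrite mem_filter w0.
  by rewrite ltr_pdivrMr ?oppr_gt0//; lra.
- have /aup : - S w / w i0 \in [seq - S u / u i0 | u <- pos].
    by apply: map_f; rewrite mem_filter w0.
  by rewrite ltr_pdivlMr//; lra.
- by rewrite w0 mulr0 add0r S_nneg// w0.
Qed.

(** Ville's theorem; equivalently the minimax theorem for finite matrix games. *)
Lemma matrix_alternative (R : realFieldType) (I J : finType) (B : J -> I -> R) :
  (exists la : J -> R, [/\ forall j, 0 <= la j, \sum_j la j = 1 &
     forall i, 0 <= \sum_j la j * B j i]) \/
  (exists A : I -> R, (forall i, 0 <= A i) /\
     forall j, \sum_i A i * B j i < 0).
Proof.
have [||||[v [[la [la0 las ->]] vr]]|[A [A0 As]]] := @cone_alternative R I
    (index_enum I) [seq B j | j <- enum J] [set v | exists la : J -> R,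
      [/\ forall j, 0 <= la j, 0 < \sum_j la j
        & v = fun i => \sum_j la j * B j i]].
- exact: index_enum_uniq.
- move=> _ /mapP[j _ ->]; exists (fun k => (k == j)%:R); split=> //.
    by rewrite (bigD1 j)//= eqxx big1 ?addr0// => k /negbTE ->.
  apply/funext => i; rewrite (bigD1 j)//= eqxx mul1r big1 ?addr0// => k /negbTE ->.
  by rewrite mul0r.
- move=> u v [la [la0 las ->]] [mu [mu0 mus ->]].
  exists (fun j => la j + mu j); split=> [j||].
  + exact: addr_ge0.
  + by rewrite big_split addr_gt0.
  + apply/funext => i; rewrite -big_split; apply: eq_bigr => j _ /=.
    by rewrite mulrDl.
- move=> k v k0 [la [la0 las ->]]; exists (fun j => k * la j); split=> [j||].
  + by rewrite mulr_ge0// ltW.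
  + by rewrite -mulr_sumr mulr_gt0.
  + apply/funext => i; rewrite mulr_sumr; apply: eq_bigr => j _ /=.
    by rewrite mulrA.
- left; exists (fun j => la j / \sum_j la j); split=> [j||i].
  + by rewrite divr_ge0// ltW.
  + by rewrite -mulr_suml divff// gt_eqF.
  + under eq_bigr => j _ do rewrite mulrAC.
    rewrite -mulr_suml divr_ge0//; last exact: ltW.
    exact: vr (mem_index_enum i).
right; exists A; split => // j; apply: As; apply: map_f; exact: mem_enum.
Qed.

Definition is_cut (R : realType) (V : Type) (f : V -> R) :=
  forall x, f x = 1 \/ f x = -1.

(** The dual description of the cut polytope: every linear inequality that holds
for all cuts of finitely many points holds for [K] at these points. Stated so,
the condition passes to averages and to limits with no convex combination in
sight. The points [p v] may repeat. *)
Definition cut_kernel (R : realType) (T : Type) (D : set T) (K : T -> T -> R) :=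
  forall (V : finType) (p : V -> T) (c : V -> V -> R) (m : R),
  (forall v, D (p v)) ->
  (forall f, is_cut f -> \sum_u \sum_v c u v * (f u * f v) <= m) ->
  \sum_u \sum_v c u v * K (p u) (p v) <= m.

Lemma is_cutP (R : realType) (V : finType) (f : V -> R) : is_cut f ->
  exists b : {ffun V -> bool}, f = fun x => if b x then 1 else -1.
Proof.
move=> fcut; exists [ffun x => f x == 1]; apply/funext => x; rewrite ffunE.
by case: eqP => // ?; case: (fcut x).
Qed.

Lemma conv_matrixE (R : realType) (V : finType) (k : {i01 R})
    (K L : convex_lmodType (V -> V -> R^o)) (x y : V) :
  (conv k K L : V -> V -> R^o) x y =
  k%:num * (K : V -> V -> R^o) x y + (1 - k%:num) * (L : V -> V -> R^o) x y.
Proof. by []. Qed.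

(** The nontrivial direction is the separation of a matrix from a polytope. An
equality [K = M] is a pair of opposite inequalities, whence the rows indexed by
[V * V * bool]; the cone consists of the multiples of [K - M], [K] in the hull. *)
Lemma cut_polytopeP (R : realType) (V : finType) (M : V -> V -> R^o) :
  cut_polytope M <-> cut_kernel setT M.
Proof.
split.
  apply: smallest_sub; last first.
    move=> _ [f [fcut ->]] W p c m _ /(_ (f \o p)); apply.
    by move=> x; exact: fcut.
  move=> K L k; rewrite !inE => /= Kcut Lcut W p c m pD cm.
  have := Kcut W p c m pD cm; have := Lcut W p c m pD cm.
  set SL := (X in X <= m) => SLm; set SK := (X in X <= m) => SKm.
  have -> : \sum_u \sum_v c u v * (conv k K L : V -> V -> R^o) (p u) (p v) =
            k%:num * SK + (1 - k%:num) * SL.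
    rewrite /SK /SL !mulr_sumr -big_split; apply: eq_bigr => u _ /=.
    rewrite !mulr_sumr -big_split; apply: eq_bigr => v _ /=.
    rewrite conv_matrixE.
    by ring.
  have k0 : 0 <= k%:num by []. have k1 : k%:num <= 1 by [].
  nra.
move=> Mcut.
pose B (b : {ffun V -> bool}) (i : V * V * bool) : R :=
  let f x := if b x then 1 else -1 : R in
  (if i.2 then 1 else -1) * (f i.1.1 * f i.1.2 - M i.1.1 i.1.2).
have [||||[_ [[m [K [m0 Khull ->]]] K0]]|[A [A0 As]]] :=
  @cone_alternative R _ (index_enum _) [seq B b | b <- enum {ffun V -> bool}]
    [set v | exists (m : R) (K : V -> V -> R^o), [/\ 0 < m, cut_polytope K &
       v = fun i => m * ((if i.2 then 1 else -1) *
                         (K i.1.1 i.1.2 - M i.1.1 i.1.2))]].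
- exact: index_enum_uniq.
- move=> _ /mapP[b _ ->]; exists 1.
  exists (fun x y => (if b x then 1 else -1) * (if b y then 1 else -1)).
  split=> //; last by apply/funext => i; rewrite mul1r.
  apply: sub_gen_smallest; exists (fun x => if b x then 1 else -1).
  by split=> // x; case: ifP => _; [left|right].
- move=> u v [m [K [m0 Kcut ->]]] [l [L [l0 Lcut ->]]].
  have ml : 0 < m + l by lra.
  have k0 : 0 <= m / (m + l) by rewrite divr_ge0// ltW.
  have k1 : m / (m + l) <= 1 by rewrite ler_pdivrMr//; lra.
  exists (m + l), (conv (Itv01 k0 k1) (K : convex_lmodType _) (L : convex_lmodType _)).
  split=> //.
    move=> X XP; rewrite -in_setE; apply: (XP.1); rewrite in_setE.
      exact: Kcut.
    exact: Lcut.
  apply/funext => -[[x y] b] /=.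
  rewrite conv_matrixE /=.
  by field; rewrite gt_eqF.
- move=> k v k0 [m [K [m0 Kcut ->]]]; exists (k * m), K; split => //.
    exact: mulr_gt0.
  by apply/funext => i; rewrite mulrA.
- suff -> : M = K by [].
  apply/funext => x; apply/funext => y; apply/eqP; rewrite eq_le.
  have := K0 (x, y, true) (mem_index_enum _); rewrite /= pmulr_rge0// => h1.
  have := K0 (x, y, false) (mem_index_enum _); rewrite /= pmulr_rge0// => h2.
  by apply/andP; split; lra.
exfalso.
pose c x y := A (x, y, true) - A (x, y, false).
have sumE (F : V -> V -> R) : \sum_(i : V * V * bool)
    A i * ((if i.2 then 1 else -1) * F i.1.1 i.1.2) = \sum_x \sum_y c x y * F x y.
  rewrite pair_bigA /= (eq_bigr (fun i =>
    \sum_(b : bool) A (i, b) * ((if b then 1 else -1) * F i.1 i.2))).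
    by rewrite pair_bigA; apply: eq_bigr => -[[]].
  by move=> -[x y] _; rewrite big_bool /c /=; ring.
have cB (b : {ffun V -> bool}) :
    \sum_x \sum_y c x y * ((if b x then 1 else -1) * (if b y then 1 else -1)) <
    \sum_x \sum_y c x y * M x y.
  have := As _ (map_f B (mem_enum _ b)).
  rewrite (sumE (fun x y => (if b x then 1 else -1) * (if b y then 1 else -1) - M x y)).
  move=> h; rewrite -subr_lt0 -sumrB; move: h; congr (_ < 0); apply: eq_bigr => x _.
  by rewrite -sumrB; apply: eq_bigr => y _; rewrite mulrBr.
pose F (b : {ffun V -> bool}) :=
  \sum_x \sum_y c x y * ((if b x then 1 else -1) * (if b y then 1 else -1)).
have [b _ bmax] := @arg_maxP _ _ _ [ffun=> true] xpredT F isT.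
have := Mcut V id c (F b) (fun=> I); rewrite leNgt cB => /(_ _)/negP; apply => //.
by move=> f /is_cutP[b' ->]; exact: bmax.
Qed.

(** * Kernels satisfying all cut inequalities *)

Lemma cut_kernel_comp (R : realType) (S T : Type) (D : set T) (E : set S)
    (g : S -> T) (K : T -> T -> R) :
  (forall x, E x -> D (g x)) -> cut_kernel D K ->
  cut_kernel E (fun x y => K (g x) (g y)).
Proof.
by move=> ED Kcut V p c m pE cm; apply: (Kcut V (g \o p)) => // v; exact: ED.
Qed.

Lemma cut_kernel_avg (R : realType) (T : Type) (D : set T) (I : finType)
    (w : I -> R) (K : I -> T -> T -> R) :
  (forall i, 0 <= w i) -> \sum_i w i = 1 -> (forall i, cut_kernel D (K i)) ->
  cut_kernel D (fun x y => \sum_i w i * K i x y).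
Proof.
move=> w0 w1 Kcut V p c m pD cm.
have -> : \sum_u \sum_v c u v * (\sum_i w i * K i (p u) (p v)) =
    \sum_i w i * \sum_u \sum_v c u v * K i (p u) (p v).
  transitivity (\sum_u \sum_v \sum_i w i * (c u v * K i (p u) (p v))).
    apply: eq_bigr => u _; apply: eq_bigr => v _.
    by rewrite mulr_sumr; apply: eq_bigr => i _; rewrite mulrCA.
  under eq_bigr => u _ do rewrite exchange_big.
  rewrite exchange_big; apply: eq_bigr => i _ /=.
  by rewrite mulr_sumr; apply: eq_bigr => u _; rewrite mulr_sumr.
rewrite -[m]mul1r -w1 mulr_suml ler_sum// => i _.
by rewrite ler_wpM2l// Kcut.
Qed.

Lemma cut_kernel_approx (R : realType) (T : Type) (D : set T)
    (K : T -> T -> R) :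
  (forall e, 0 < e -> exists K', cut_kernel D K' /\
     forall x y, D x -> D y -> `|K' x y - K x y| <= e) ->
  cut_kernel D K.
Proof.
move=> Kapp V p c m pD cm; apply/ler_addgt0Pr => e e0.
pose C := \sum_u \sum_v `|c u v| + 1.
have C0 : 0 < C.
  by rewrite ltr_wpDl// sumr_ge0// => u _; rewrite sumr_ge0.
have [|K' [K'cut K'K]] := Kapp (e / C); first by rewrite divr_gt0.
apply: le_trans (lerD (K'cut V p c m pD cm) (lexx e)).
rewrite -lerBlDl.
have -> : \sum_u \sum_v c u v * K (p u) (p v) -
    \sum_u \sum_v c u v * K' (p u) (p v) =
    \sum_u \sum_v c u v * (K (p u) (p v) - K' (p u) (p v)).
  rewrite -sumrB; apply: eq_bigr => u _.
  by rewrite -sumrB; apply: eq_bigr => v _; rewrite mulrBr.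
apply: (@le_trans _ _ (\sum_u \sum_v `|c u v| * (e / C))); last first.
  under eq_bigr => u _ do rewrite -mulr_suml.
  rewrite -mulr_suml mulrCA ger_pMr// ler_pdivrMr// mul1r.
  by rewrite /C lerDl.
apply: ler_sum => u _; apply: ler_sum => v _.
apply: (le_trans (ler_norm _)); rewrite normrM distrC.
by rewrite ler_wpM2l// K'K.
Qed.

Lemma sum_delta (R : realType) (V : finType) (k : V * V) (F : V -> V -> R) :
  \sum_u \sum_v ((u, v) == k)%:R * F u v = F k.1 k.2.
Proof.
rewrite pair_bigA (bigD1 k)//= -surjective_pairing eqxx mul1r big1 ?addr0//.
by move=> i /negbTE; rewrite -surjective_pairing => ->; rewrite mul0r.
Qed.

Lemma cut_kernel_le1 (R : realType) (T : Type) (D : set T) (K : T -> T -> R)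
    x y : cut_kernel D K -> D x -> D y -> K x y <= 1.
Proof.
move=> Kcut Dx Dy; pose p (b : bool) := if b then x else y.
have := Kcut _ p (fun u v => ((u, v) == (true, false))%:R) 1.
rewrite (sum_delta _ (fun u v => K (p u) (p v))); apply; first by case.
move=> f fcut; rewrite (sum_delta _ (fun u v => f u * f v)) /=.
by case: (fcut true) (fcut false) => -> [] ->; lra.
Qed.

(** Two points separated by a cut are separated from any third point in at
least one way: [1 - K] is a convex combination of cut semimetrics. *)
Lemma cut_kernel_triangle (R : realType) (T : Type) (D : set T)
    (K : T -> T -> R) x y z : cut_kernel D K -> D x -> D y -> D z ->
  1 - K x z <= (1 - K x y) + (1 - K y z).
Proof.
move=> Kcut Dx Dy Dz.
pose p (i : 'I_3) := nth x [:: x; y; z] i.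
pose c (i j : 'I_3) : R :=
  ((i, j) == (inord 0, inord 1))%:R + ((i, j) == (inord 1, inord 2))%:R
  - ((i, j) == (inord 0, inord 2))%:R.
have sumE (F : 'I_3 -> 'I_3 -> R) : \sum_i \sum_j c i j * F i j =
    F (inord 0) (inord 1) + F (inord 1) (inord 2) - F (inord 0) (inord 2).
  rewrite -(sum_delta (inord 0, inord 1) F) -(sum_delta (inord 1, inord 2) F).
  rewrite -(sum_delta (inord 0, inord 2) F) -big_split -sumrB; apply: eq_bigr => i _ /=.
  rewrite -big_split -sumrB; apply: eq_bigr => j _ /=.
  by rewrite /c mulrBl mulrDl.
have := Kcut _ p c 1; rewrite (sumE (fun u v => K (p u) (p v))).
rewrite /p !inordK// => /(_ _ _)/wrap[||].
- by move=> v; case: v => [[|[|[|]]]].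
- move=> f fcut; rewrite (sumE (fun u v => f u * f v)).
  by case: (fcut (inord 0)) (fcut (inord 1)) (fcut (inord 2)) => -> [] -> [] ->; lra.
by rewrite /=; lra.
Qed.

(** A function [g] with values in [0, M] is cut at a random threshold in [0, M];
the expected product of the resulting signs at [u] and [v] is
[1 - 2 * |g u - g v| / M]. Integration over the threshold is replaced by
induction on the number of positive values of [g]: thresholds below the
smallest positive value [s] all produce the cut [f] between the positive points
and the others, and lowering the positive values by [s] accounts for the
remaining thresholds. *)
Lemma layer_cake (R : realType) (V : finType) (c : V -> V -> R) (m : R) :
  (forall f, is_cut f -> \sum_u \sum_v c u v * (f u * f v) <= m) ->
  forall (k : nat) (g : V -> R) (M : R), 0 <= M ->
  (#|[set u | (0 < g u)%R]%SET| <= k)%N ->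
  (forall u, 0 <= g u <= M) ->
  \sum_u \sum_v c u v * (M - 2 * `|g u - g v|) <= m * M.
Proof.
move=> cm; elim=> [|k IH] g M M0 gk gM.
  have g0 u : g u = 0.
    move: gk; rewrite leqn0 cards_eq0 => /eqP/setP/(_ u); rewrite !inE.
    by have /andP[] := gM u; case: ltgtP => //.
  have := cm (fun=> 1) (fun=> or_introl erefl).
  move/(ler_wpM2r M0); rewrite mulr_suml; congr (_ <= _).
  apply: eq_bigr => u _; rewrite mulr_suml; apply: eq_bigr => v _.
  by rewrite !g0 subrr normr0; ring.
have [/eqP|/set0Pn[u0]] := eqVneq [set u | 0 < g u]%SET finset.set0.
  by rewrite -cards_eq0 => /eqP gk0; apply: IH => //; rewrite gk0.
rewrite inE => gu0.
have [a ga amin] := @arg_minP _ _ _ u0 (fun u => 0 < g u) g gu0.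
pose s := g a.
pose f u : R := if 0 < g u then 1 else -1.
pose g' u := if 0 < g u then g u - s else 0.
have fcut : is_cut f by move=> u; rewrite /f; case: ifP; [left|right].
have sM : s <= M by have /andP[] := gM a.
have -> : \sum_u \sum_v c u v * (M - 2 * `|g u - g v|) =
    s * (\sum_u \sum_v c u v * (f u * f v)) +
    \sum_u \sum_v c u v * ((M - s) - 2 * `|g' u - g' v|).
  rewrite mulr_sumr -big_split; apply: eq_bigr => u _ /=.
  rewrite mulr_sumr -big_split; apply: eq_bigr => v _ /=.
  rewrite (mulrCA s) -mulrDr; congr (_ * _).
  have pos0 w : 0 < g w = false -> g w = 0.
    by have /andP[] := gM w; case: ltgtP.
  rewrite /f /g'; case: ifP => [gu|/pos0 gu]; case: ifP => [gv|/pos0 gv].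
  - by rewrite (_ : g u - s - (g v - s) = g u - g v); ring.
  - have := amin u gu; rewrite gv !subr0 -/s => su.
    by rewrite !ger0_norm ?subr_ge0// ?(ltW gu)//; ring.
  - have := amin v gv; rewrite gu !sub0r !normrN -/s => sv.
    by rewrite !ger0_norm ?subr_ge0// ?(ltW gv)//; ring.
  - by rewrite gu gv subrr normr0; ring.
have s0 : 0 <= s by exact: ltW.
have /IH : 0 <= M - s by rewrite subr_ge0.
move=> /(_ g' _ _)/wrap[||IHg].
- rewrite -ltnS; apply: leq_trans gk; apply: proper_card; apply/properP; split.
    by apply/fintype.subsetP => u; rewrite !inE /g'; case: ifP; rewrite ?ltxx.
  by exists a; rewrite !inE// /g' ga subrr ltxx.
- move=> u; rewrite /g'; case: ifP => gu; last by rewrite lexx subr_ge0.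
  by rewrite subr_ge0 amin//= lerD2r; have /andP[] := gM u.
have := ler_wpM2l s0 (cm f fcut).
by lra.
Qed.

Lemma cut_kernel_threshold (R : realType) (T : Type) (D : set T) (h : T -> R) :
  (forall x, D x -> `|h x| <= 1) ->
  cut_kernel D (fun x y => 1 - `|h x - h y|).
Proof.
move=> h1 V p c m pD cm.
have := @layer_cake R V c m cm _ (fun u => (1 + h (p u)) / 2) 1 ler01 (leqnn _).
rewrite mulr1 => /(_ _)/wrap[u|].
  by have := h1 _ (pD u); rewrite ler_norml => /andP[? ?]; apply/andP; split; lra.
congr (_ <= _); apply: eq_bigr => u _; apply: eq_bigr => v _.
congr (_ * (_ - _)).
rewrite (_ : (1 + h (p u)) / 2 - (1 + h (p v)) / 2 =
  (h (p u) - h (p v)) / 2); last by ring.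
by rewrite normrM (ger0_norm (_ : 0 <= 2^-1))//; field.
Qed.

(** * Spheres, orthogonal matrices and finite nets *)

Section Sphere.
Variables (R : realType) (n : nat).
Implicit Types (x y z : 'cV[R]_n) (T : 'M[R]_n).

Lemma sum_ord_const (c : R) : \sum_(i < n) c = n%:R * c.
Proof. by rewrite sumr_const card_ord mulr_natl. Qed.

Lemma coord_le_norm x i : `|x i 0| <= `|x|.
Proof.
rewrite [leRHS]/Num.Def.normr /= mx_normrE.
by rewrite (le_bigmax _ (fun ij => `|x ij.1 ij.2|) (i, 0)).
Qed.

Lemma norm_le_coord x e : 0 <= e -> (forall i, `|x i 0| <= e) -> `|x| <= e.
Proof.
move=> e0 xe; rewrite [leLHS]/Num.Def.normr /= mx_normrE; apply: bigmax_le => //.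
by move=> [i j] _; rewrite (ord1 j).
Qed.

Lemma dot_mulmx x y : dot x y = (x^T *m y) 0 0.
Proof. by rewrite !mxE; apply: eq_bigr => i _; rewrite mxE. Qed.

Lemma dotC x y : dot x y = dot y x.
Proof. by apply: eq_bigr => i _; rewrite mulrC. Qed.

Lemma dotDl x y z : dot (x + y) z = dot x z + dot y z.
Proof. by rewrite -big_split; apply: eq_bigr => i _; rewrite mxE mulrDl. Qed.

Lemma dotZl a x z : dot (a *: x) z = a * dot x z.
Proof. by rewrite mulr_sumr; apply: eq_bigr => i _; rewrite mxE mulrA. Qed.

Lemma dotBl x y z : dot (x - y) z = dot x z - dot y z.
Proof. by rewrite dotDl -scaleN1r dotZl mulN1r. Qed.

Lemma dotDr x y z : dot z (x + y) = dot z x + dot z y.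
Proof. by rewrite dotC dotDl !(dotC z). Qed.

Lemma dotZr a x z : dot z (a *: x) = a * dot z x.
Proof. by rewrite dotC dotZl dotC. Qed.

Lemma dotBr x y z : dot z (x - y) = dot z x - dot z y.
Proof. by rewrite dotC dotBl !(dotC z). Qed.

Lemma dot_ge0 x : 0 <= dot x x.
Proof. by apply: sumr_ge0 => i _; rewrite -expr2 sqr_ge0. Qed.

Lemma dot_eq0 x : dot x x = 0 -> x = 0.
Proof.
move=> /psumr_eq0P x0; apply/matrixP => i j; rewrite (ord1 j) mxE.
apply/eqP; rewrite -[_ == _]orbb -mulf_eq0; apply/eqP/x0 => //.
by move=> k _; rewrite -expr2 sqr_ge0.
Qed.

Lemma sphere_coord_le1 x i : sphere x -> `|x i 0| <= 1.
Proof.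
move=> xS; rewrite -(@ler_pXn2r _ 2)// ?nnegrE// expr1n real_normK ?num_real//.
rewrite -[leRHS]xS /dot (bigD1 i)//= expr2 lerDl.
by apply: sumr_ge0 => j _; rewrite -expr2 sqr_ge0.
Qed.

Lemma sphere_norm_le1 x : sphere x -> `|x| <= 1.
Proof. by move=> xS; apply: norm_le_coord => // i; exact: sphere_coord_le1. Qed.

Lemma sphere_dot_itv x y : sphere x -> sphere y -> -1 <= dot x y <= 1.
Proof.
move=> xS yS; have := dot_ge0 (x - y); have := dot_ge0 (x + y).
rewrite dotBl !dotBr dotDl !dotDr (dotC y x) xS yS => h1 h2.
by apply/andP; split; lra.
Qed.

Lemma dot_lipschitz x y x' y' :
  sphere x -> sphere y' ->
  `|dot x y - dot x' y'| <= n%:R * (`|x - x'| + `|y - y'|).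
Proof.
move=> xS y'S; rewrite /dot -sumrB; apply: (le_trans (ler_norm_sum _ _ _)).
rewrite -sum_ord_const.
apply: ler_sum => i _.
have -> : x i 0 * y i 0 - x' i 0 * y' i 0 =
    (x - x') i 0 * y' i 0 + x i 0 * (y - y') i 0 by rewrite !mxE; ring.
apply: (le_trans (ler_normD _ _)); rewrite !normrM; apply: lerD.
  rewrite -[leRHS]mulr1; apply: ler_pM => //; first exact: coord_le_norm.
  exact: sphere_coord_le1.
rewrite -[leRHS]mul1r; apply: ler_pM => //; last exact: coord_le_norm.
exact: sphere_coord_le1.
Qed.

Lemma orthogonal_mx1 : orthogonal_mx (1%:M : 'M[R]_n).
Proof. by rewrite /orthogonal_mx trmx1 mulmx1. Qed.

Lemma orthogonal_mxM T U :
  orthogonal_mx T -> orthogonal_mx U -> orthogonal_mx (T *m U).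
Proof.
rewrite /orthogonal_mx => TO UO.
by rewrite trmx_mul -mulmxA (mulmxA _ T) TO mul1mx.
Qed.

Lemma orthogonal_mxV T : orthogonal_mx T -> T *m T^T = 1%:M.
Proof. exact: mulmx1C. Qed.

Lemma orthogonal_trmx T : orthogonal_mx T -> orthogonal_mx T^T.
Proof. by move=> TO; rewrite /orthogonal_mx trmxK orthogonal_mxV. Qed.

Lemma orthogonal_dot T x y : orthogonal_mx T -> dot (T *m x) (T *m y) = dot x y.
Proof.
by move=> TO; rewrite !dot_mulmx trmx_mul -mulmxA (mulmxA _ T) TO mul1mx.
Qed.

Lemma orthogonal_sphere T x : orthogonal_mx T -> sphere x -> sphere (T *m x).
Proof. by move=> TO xS; rewrite /sphere /= orthogonal_dot. Qed.

Lemma orthogonal_entry_le1 T i j : orthogonal_mx T -> `|T i j| <= 1.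
Proof.
move=> TO; have := @sphere_coord_le1 (col j T) i; rewrite mxE; apply.
move/matrixP/(_ j j): TO; rewrite !mxE eqxx mulr1n => TO.
by rewrite /sphere /= -[RHS]TO; apply: eq_bigr => k _; rewrite !mxE.
Qed.

Lemma mulmx_norm_le (A : 'M[R]_n) x e : 0 <= e ->
  (forall i j, `|A i j| <= e) -> `|A *m x| <= n%:R * e * `|x|.
Proof.
move=> e0 Ae; apply: norm_le_coord => [|i].
  by rewrite !mulr_ge0.
rewrite mxE; apply: (le_trans (ler_norm_sum _ _ _)).
rewrite -mulrA -sum_ord_const; apply: ler_sum => j _.
by rewrite normrM ler_pM// coord_le_norm.
Qed.

(** The reflection in the hyperplane orthogonal to [x - y], or the identity when
[x = y]. *)
Lemma reflection_exists x y : dot x x = dot y y ->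
  exists T, [/\ orthogonal_mx T, T *m x = y &
    forall z, dot z x = dot z y -> T *m z = z].
Proof.
move=> xy; have [vE|v0] := eqVneq (x - y) 0.
  exists 1%:M; split; first exact: orthogonal_mx1.
    by rewrite mul1mx; apply/eqP; rewrite -subr_eq0 vE.
  by move=> z _; rewrite mul1mx.
pose v := x - y; pose d := dot v v.
have d0 : d != 0 by apply: contra_neq v0; exact: dot_eq0.
pose T := 1%:M - (2 / d) *: (v *m v^T).
have TE z : T *m z = z - (2 / d * dot v z) *: v.
  rewrite mulmxBl mul1mx -scalemxAl -mulmxA; congr (_ - _).
  rewrite [v^T *m z]mx11_scalar -dot_mulmx mul_mx_scalar scalerA; congr (_ *: _).
have TT : T^T = T.
  by rewrite /T linearB /= trmx1 linearZ /= trmx_mul trmxK.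
exists T; split.
- rewrite /orthogonal_mx TT; apply/matrixP => i j.
  have TTz z : T *m (T *m z) = z.
    rewrite TE TE dotBr dotZr -/d.
    rewrite -addrA -opprD -scalerDl -mulrDr.
    have -> : dot v z + (dot v z - 2 / d * dot v z * d) = 0 by field.
    by rewrite mulr0 scale0r subr0.
  have /matrixP/(_ i 0) := TTz (delta_mx j 0).
  by rewrite mulmxA -colE !mxE andbT eq_sym.
- have -> : y = x - v by rewrite /v subKr.
  have dvx : dot v x = d / 2.
    rewrite /d /v !dotBl !dotBr (dotC y x) -xy; by field.
  rewrite TE dvx (_ : 2 / d * (d / 2) = 1) ?scale1r//; by field.
- by move=> z zxy; rewrite TE dotC dotBr zxy subrr mulr0 scale0r subr0.
Qed.

(** A first reflection moves [x] to [x']; a second one moves the image of [y] to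
[y'], and it fixes [x'] because the inner products agree. *)
Lemma orthogonal_pair_transitive x y x' y' :
  sphere x -> sphere y -> sphere x' -> sphere y' -> dot x y = dot x' y' ->
  exists T, [/\ orthogonal_mx T, T *m x = x' & T *m y = y'].
Proof.
move=> xS yS x'S y'S xy.
have [|T [TO Tx _]] := @reflection_exists x x'; first by rewrite xS x'S.
have [|U [UO Uy UP]] := @reflection_exists (T *m y) y'.
  by rewrite orthogonal_dot// yS y'S.
exists (U *m T); split; first exact: orthogonal_mxM.
  by rewrite -mulmxA Tx UP// -{1}Tx orthogonal_dot.
by rewrite -mulmxA.
Qed.

Lemma sphere_pair_exists t : (2 <= n)%N -> -1 <= t <= 1 ->
  exists x y, [/\ sphere x, sphere y & dot x y = t].
Proof.
move=> n2 /andP[t1 t2].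
pose i0 : 'I_n := Ordinal (ltnW n2); pose i1 : 'I_n := Ordinal n2.
have dotd i (z : 'cV[R]_n) : dot (delta_mx i 0) z = z i 0.
  rewrite /dot (bigD1 i)//= !mxE !eqxx mul1r big1 ?addr0// => j /negbTE ji.
  by rewrite mxE ji mul0r.
exists (delta_mx i0 0), (t *: delta_mx i0 0 + Num.sqrt (1 - t ^+ 2) *: delta_mx i1 0).
rewrite /sphere /=; split.
- by rewrite dotd mxE !eqxx.
- rewrite !(dotDl, dotDr, dotZl, dotZr) !dotd !mxE !eqxx /= !mulr0 !mulr1.
  rewrite !addr0 add0r -!expr2 sqr_sqrtr; first by ring.
  by nra.
- by rewrite dotDr !dotZr !dotd !mxE !eqxx /= mulr0 mulr1 addr0.
Qed.
End Sphere.

(** Matrices with entries in [-1, 1] are sorted into finitely many boxes by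
rounding their entries; one element of [D] is kept from each box that meets
[D]. This serves both the sphere and the orthogonal group. *)
Lemma bounded_net (R : realType) (m n : nat) (D : set 'M[R]_(m, n)) (e : R) :
  0 < e -> (forall x, D x -> forall i j, `|x i j| <= 1) ->
  exists (V : finType) (p : V -> 'M[R]_(m, n)), (forall v, D (p v)) /\
    forall x, D x -> exists v, forall i j, `|x i j - p v i j| <= e.
Proof.
move=> e0 D1; pose N := Num.truncn (2 / e).
pose code (x : 'M[R]_(m, n)) : {ffun 'I_m * 'I_n -> 'I_N.+1} :=
  [ffun ij => inord (Num.truncn ((x ij.1 ij.2 + 1) / e))].
pose V : finType :=
  {c : {ffun 'I_m * 'I_n -> 'I_N.+1} | `[< exists x, D x /\ code x = c >]}.
pose p (v : V) := projT1 (cid (asboolW (valP v))).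
have pP v : D (p v) /\ code (p v) = val v by rewrite /p; case: cid.
exists V, p; split=> [v|x Dx]; first by have [] := pP v.
have cx : `[< exists y, D y /\ code y = code x >] by apply/asboolP; exists x.
pose v : V := exist _ (code x) cx; exists v => i j.
have [Dp] := pP v; move/ffunP/(_ (i, j)); rewrite /= !ffunE /=.
have bnd y : D y -> (Num.truncn ((y i j + 1) / e) < N.+1)%N /\ 0 <= (y i j + 1) / e.
  move=> Dy; have := D1 _ Dy i j; rewrite ler_norml => /andP[y1 y2].
  split; last by rewrite divr_ge0//; [lra|exact: ltW].
  rewrite ltnS; apply: le_truncn; rewrite ler_pM2r ?invr_gt0//; lra.
have [xN x0] := bnd x Dx; have [pN p0] := bnd _ Dp.
move/(congr1 val); rewrite /= !inordK// => E.
have := truncn_itv x0; have := truncn_itv p0; rewrite E.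
set k := Num.truncn _ => /andP[h1 h2] /andP[h3 h4].
move: h1 h2 h3 h4.
rewrite !ler_pdivlMr// !ltr_pdivrMr// -[k.+1]addn1 natrD => h1 h2 h3 h4.
by rewrite ler_norml; apply/andP; split; lra.
Qed.

(** * Lipschitz rounding of finite cuts *)

Section BallCarving.
Variables (R : realType) (n : nat) (V : finType) (p : V -> 'cV[R]_n).
Variables (e : R) (N : nat).
Hypotheses (e0 : 0 < e) (N0 : (0 < N)%N).
Implicit Types (x y : 'cV[R]_n) (j : 'I_N) (f : V -> R).

Let N0R : 0 < N%:R :> R. Proof. by rewrite ltr0n. Qed.

(** The [N] radii are spread over an interval of length at most [e], two of them
differing by at least [2 * carve_width]. A point is therefore within
[carve_width] of the boundary of the ball around [p v] for at most one of them. *)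
Definition carve_radius j : R := e * (1 + j%:R / N%:R).
Definition carve_width : R := e / (2 * N%:R).

Let width0 : 0 < carve_width.
Proof. by rewrite divr_gt0// mulr_gt0. Qed.

(** Sequential ball carving: a point joins the first ball that contains it. *)
Definition carve_cell j x : option V :=
  [pick v | `|x - p v| <= carve_radius j].

Definition carve_gap j x (v : V) : R :=
  `| `|x - p v| - carve_radius j| / carve_width.

(** Vanishes on the boundaries of all balls and is 1 at distance at least
[carve_width] from them. *)
Definition carve_margin j x : R := \big[Num.min/1]_v carve_gap j x v.

(** The cut [f] of the centres, extended to all points through their cells and
tapered to 0 at the cell boundaries, which makes it Lipschitz. *)
Definition carved j f x : R := carve_margin j x * oapp f 0 (carve_cell j x).

Lemma carve_gap_lipschitz j x y v :
  carve_gap j x v <= carve_gap j y v + `|x - y| / carve_width.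
Proof.
rewrite -mulrDl ler_pM2r ?invr_gt0//.
have : `| `|x - p v| - `|y - p v| | <= `|x - y|.
  by rewrite (le_trans (ler_dist_dist _ _))// opprB addrA subrK.
set a := `|x - p v|; set b := `|y - p v|; set r := carve_radius j => h.
by rewrite (le_trans _ (lerD (lexx _) h))//
  (_ : a - r = (b - r) + (a - b)) ?ler_normD//; ring.
Qed.

Lemma carve_margin_itv j x : 0 <= carve_margin j x <= 1.
Proof.
apply/andP; split; last exact: bigmin_le_id.
by apply: le_bigmin => // v _; rewrite divr_ge0// ltW.
Qed.

Lemma carve_margin_le j x v : carve_margin j x <= carve_gap j x v.
Proof. exact: bigmin_le. Qed.

Lemma carve_margin_lipschitz j x y :
  carve_margin j x <= carve_margin j y + `|x - y| / carve_width.
Proof.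
have xy0 : 0 <= `|x - y| / carve_width by rewrite divr_ge0// ltW.
rewrite -lerBlDr; apply: le_bigmin => [|v _].
  by have /andP[_ ?] := carve_margin_itv j x; lra.
by rewrite lerBlDr (le_trans (carve_margin_le j x v))// carve_gap_lipschitz.
Qed.

Lemma carved_le1 j f x : is_cut f -> `|carved j f x| <= 1.
Proof.
move=> fcut; have /andP[m0 m1] := carve_margin_itv j x.
rewrite normrM (ger0_norm m0) -[leRHS]mulr1 ler_pM//.
case: carve_cell => [v|]; rewrite /= ?normr0//.
by case: (fcut v) => ->; rewrite ?normrN normr1.
Qed.

(** If [x] and [y] lie in the same balls, they have the same cell and the margin
is Lipschitz. Otherwise a sphere around some centre separates them, so both
margins are at most their distances to it, which add up to at most [|x - y|]. *)
Lemma carved_lipschitz j f x y : is_cut f ->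
  `|carved j f x - carved j f y| <= `|x - y| / carve_width.
Proof.
move=> fcut.
have sign1 o : `|oapp f 0 o| <= 1 :> R.
  case: o => [v|]; rewrite /= ?normr0//.
  by case: (fcut v) => ->; rewrite ?normrN normr1.
have /andP[mx0 _] := carve_margin_itv j x.
have /andP[my0 _] := carve_margin_itv j y.
have [same|/existsNP[v diff]] := pselect (forall v,
    (`|x - p v| <= carve_radius j) = (`|y - p v| <= carve_radius j)).
  rewrite /carved (_ : carve_cell j x = carve_cell j y); last exact: eq_pick.
  rewrite -mulrBl normrM -[leRHS]mulr1 ler_pM//.
  have := carve_margin_lipschitz j x y; have := carve_margin_lipschitz j y x.
  by rewrite distrC ler_norml => h1 h2; apply/andP; split; lra.
apply: (@le_trans _ _ (carve_margin j x + carve_margin j y)).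
  apply: (le_trans (ler_normB _ _)); rewrite /carved !normrM.
  by rewrite (ger0_norm mx0) (ger0_norm my0) lerD// ler_piMr.
apply: (le_trans (lerD (carve_margin_le j x v) (carve_margin_le j y v))).
rewrite /carve_gap -mulrDl ler_pM2r ?invr_gt0//.
have : `| `|x - p v| - `|y - p v| | <= `|x - y|.
  by rewrite (le_trans (ler_dist_dist _ _))// opprB addrA subrK.
move: diff; rewrite ler_norml.
case: leP => a1; case: leP => a2 // _ /andP[h1 h2].
- by rewrite ler0_norm ?subr_le0// ger0_norm ?subr_ge0 ?(ltW a2)//; lra.
- by rewrite ger0_norm ?subr_ge0 ?(ltW a1)// ler0_norm ?subr_le0//; lra.
Qed.

Definition carve_bad x : {set 'I_N} := [set j | carve_margin j x < 1]%SET.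

(** A bad radius for [x] comes with a centre whose ball has [x] near its boundary,
and no centre serves two radii. The bound does not depend on [N]: for [N] large
almost every radius is good. *)
Lemma card_carve_bad x : (#|carve_bad x| <= #|V|)%N.
Proof.
pose w j : option V := [pick v | carve_gap j x v < 1].
have wP j : j \in carve_bad x -> exists2 v, w j = Some v & carve_gap j x v < 1.
  rewrite inE => bad; rewrite /w; case: pickP => [v gv|nogap]; first by exists v.
  move: bad; rewrite ltNge; suff -> : 1 <= carve_margin j x by [].
  by apply: le_bigmin => // v _; rewrite leNgt nogap.
have winj : {in carve_bad x &, injective w}.
  move=> i j /wP[v wi gi] /wP[v' wj gj]; rewrite wi wj => -[vv'].
  rewrite -{}vv' {wi wj} in gj.
  apply/eqP; apply: contraT => ij.
  move: gi gj; rewrite /carve_gap !ltr_pdivrMr// !mul1r !ltr_norml.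
  move=> /andP[i1 i2] /andP[j1 j2].
  have : `|carve_radius i - carve_radius j| < 2 * carve_width.
    by rewrite ltr_norml; apply/andP; split; lra.
  have -> : carve_radius i - carve_radius j = (i%:R - j%:R) * (e / N%:R).
    by rewrite /carve_radius; field; rewrite gt_eqF.
  have -> : 2 * carve_width = e / N%:R.
    by rewrite /carve_width; field; rewrite gt_eqF.
  have eN0 : 0 < e / N%:R by rewrite divr_gt0.
  rewrite normrM (gtr0_norm eN0) -ltr_pdivlMr// divff ?gt_eqF//.
  wlog lt_ij : i j ij {i1 i2 j1 j2} / (i < j)%N => [wl|].
    case: (ltngtP i j) => [||/val_inj ijE]; first exact: wl.
      by rewrite distrC; apply: wl; rewrite // eq_sym.
    by rewrite ijE eqxx in ij.
  rewrite distrC -natrB 1?ltnW// normr_nat ltrn1.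
  by rewrite ltnS leqn0 subn_eq0 leqNgt lt_ij.
have some_inj : injective (@Some V) by move=> ? ? [].
rewrite -(card_in_imset winj) -[leqRHS](card_imset _ some_inj).
apply: subset_leq_card; apply/fintype.subsetP => _ /imsetP[j /wP[v -> _] ->].
exact: imset_f.
Qed.
End BallCarving.

(** The Lipschitz rounding of a finite solution. For points [V] forming a fine
net, the convex combination of cuts given by the hypothesis is transported to
the sphere by [carved], and turned into a cut kernel by a random threshold. At
a radius that is good for both [x] and [y] the kernel takes its value at the two
cell centres, which are close to [x] and [y]; the few bad radii cost at most
[d / 2] after averaging. *)
Lemma rounded_kernel (R : realType) (n : nat) (b d : R) : 0 <= b -> 0 < d ->
  (forall (V : finType) (p : V -> 'cV[R]_n), (forall v, sphere (p v)) ->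
     exists (J : finType) (la : J -> R) (f : J -> V -> R),
     [/\ forall j, 0 <= la j, \sum_j la j = 1, forall j, is_cut (f j)
       & forall u v, b * (1 - dot (p u) (p v)) <=
                     \sum_j la j * (1 - f j u * f j v)]) ->
  exists (K : 'cV[R]_n -> 'cV[R]_n -> R) (L : R),
  [/\ 0 <= L, cut_kernel (@sphere R n) K,
      forall x y x' y', `|K x y - K x' y'| <= L * (`|x - x'| + `|y - y'|)
    & forall x y, sphere x -> sphere y -> b * (1 - dot x y) - d <= 1 - K x y].
Proof.
move=> b0 d0 dual.
have nb0 : 0 <= n%:R * b by rewrite mulr_ge0.
pose e := d / (8 * (n%:R * b + 1)).
have e0 : 0 < e by rewrite divr_gt0// mulr_gt0//; lra.
have [|V [p [pS net]]] := @bounded_net R n 1 (@sphere R n) e e0.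
  by move=> x xS i j; rewrite (ord1 j); exact: sphere_coord_le1.
have {}net x : sphere x -> exists v, `|x - p v| <= e.
  move=> /net[v xv]; exists v; apply: norm_le_coord => [|i]; first exact: ltW.
  by rewrite !mxE.
have [J [la [f [la0 la1 fcut lab]]]] := dual V p pS.
pose N := (Num.truncn (8 * b * #|V|%:R / d)).+1.
have N0R : 0 < N%:R :> R by rewrite ltr0n.
have NV : 8 * b * #|V|%:R < d * N%:R.
  rewrite mulrC (mulrC d) -ltr_pdivrMr// mulrC; exact: truncnS_gt.
pose g j i := @carved R n V p e N j (f i).
pose w (ji : 'I_N * J) := N%:R^-1 * la ji.2.
have w0 ji : 0 <= w ji by rewrite mulr_ge0// invr_ge0 ltW.
have wE (F : 'I_N -> J -> R) : \sum_ji w ji * F ji.1 ji.2 =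
    N%:R^-1 * \sum_j \sum_i la i * F j i.
  transitivity (\sum_j \sum_i w (j, i) * F j i).
    by rewrite pair_bigA; apply: eq_bigr => -[].
  rewrite mulr_sumr; apply: eq_bigr => j _.
  by rewrite mulr_sumr; apply: eq_bigr => i _; rewrite mulrA.
have w1 : \sum_ji w ji = 1.
  under eq_bigr => ji _ do rewrite -[w ji]mulr1.
  rewrite (wE (fun _ _ => 1)); under eq_bigr => j _ do
    (under eq_bigr => i _ do rewrite mulr1; rewrite la1).
  by rewrite sum_ord_const mulr1 mulVf// gt_eqF.
pose K x y := \sum_ji w ji * (1 - `|g ji.1 ji.2 x - g ji.1 ji.2 y|).
have KE x y : 1 - K x y =
    N%:R^-1 * \sum_j \sum_i la i * `|g j i x - g j i y|.
  rewrite -(wE (fun j i => `|g j i x - g j i y|)) -[1 in LHS]w1 -sumrB.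
  by apply: eq_bigr => ji _; ring.
have wid0 : 0 < carve_width e N by rewrite divr_gt0// mulr_gt0.
exists K, (carve_width e N)^-1; split.
- by rewrite invr_ge0 ltW.
- apply: cut_kernel_avg => // ji; apply: cut_kernel_threshold => x _.
  exact: carved_le1.
- move=> x y x' y'.
  rewrite -sumrB (le_trans (ler_norm_sum _ _ _))//.
  rewrite -[leRHS]mul1r -[in leRHS]w1 mulr_suml ler_sum// => -[j i] _ /=.
  rewrite -mulrBr normrM (ger0_norm (w0 _)) ler_wpM2l//.
  rewrite mulrC mulrDl.
  have := @carved_lipschitz R n V p e N e0 isT j (f i) x x' (fcut i).
  have := @carved_lipschitz R n V p e N e0 isT j (f i) y y' (fcut i).
  rewrite -/(g j i); set gx := g j i x; set gy := g j i y.
  set gx' := g j i x'; set gy' := g j i y' => hy hx.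
  have h1 := ler_dist_dist (gx - gy) (gx' - gy').
  have h2 := ler_normB (gx - gx') (gy - gy').
  rewrite (_ : 1 - _ - _ = - (`|gx - gy| - `|gx' - gy'|)); last by ring.
  rewrite normrN (le_trans h1)//
    (_ : gx - gy - _ = gx - gx' - (gy - gy')); last by ring.
  by rewrite (le_trans h2)// lerD.
move=> x y xS yS; rewrite KE.
pose D := b * (1 - dot x y - n%:R * (4 * e)).
have /andP[dot1 dot2] := sphere_dot_itv xS yS.
have ne0 : 0 <= n%:R * (4 * e) by rewrite mulr_ge0// mulr_ge0// ltW.
have Dle : D <= 2 * b by rewrite /D mulrC ler_wpM2r//; lra.
pose bad z j : R := (j \in carve_bad p e N z)%:R.
have sum_bad z : \sum_j bad z j <= #|V|%:R.
  rewrite -natr_sum ler_nat; apply: leq_trans (@card_carve_bad R n V p e N e0 isT z).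
  by rewrite -sum1_card [leqRHS]big_mkcond /=; apply: leq_sum => j _; case: (_ \in _).
have near_cell z (j : 'I_N) : sphere z ->
    exists2 v, carve_cell p e j z = Some v & `|z - p v| <= 2 * e.
  move=> /net[v zv]; rewrite /carve_cell; case: pickP => [u zu|/(_ v)].
    exists u => //; rewrite (le_trans zu)//.
    rewrite /carve_radius mulrC ler_wpM2r ?(ltW e0)//.
    have : j%:R / N%:R <= 1 :> R by rewrite ler_pdivrMr// mul1r ler_nat ltnW.
    by lra.
  rewrite (le_trans zv)// /carve_radius -[leLHS]mulr1 ler_wpM2l ?(ltW e0)//.
  by rewrite lerDl divr_ge0.
have good j : D - 2 * b * (bad x j + bad y j) <= \sum_i la i * `|g j i x - g j i y|.
  have sum0 : 0 <= \sum_i la i * `|g j i x - g j i y|.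
    by apply: sumr_ge0 => i _; rewrite mulr_ge0.
  have bad0 z : 0 <= bad z j by rewrite ler0n.
  case: (boolP (j \in carve_bad p e N x)) => [xbad|xgood].
    have -> : bad x j = 1 by rewrite /bad xbad.
    by apply: le_trans sum0; have := bad0 y; nra.
  case: (boolP (j \in carve_bad p e N y)) => [ybad|ygood].
    have -> : bad y j = 1 by rewrite /bad ybad.
    by apply: le_trans sum0; have := bad0 x; nra.
  have margin1 z : j \notin carve_bad p e N z -> carve_margin p e j z = 1.
    rewrite inE -leNgt => m1; apply/eqP; rewrite eq_le m1 andbT.
    by have /andP[] := @carve_margin_itv R n V p e N e0 isT j z.
  have [u xu xpu] := near_cell x j xS; have [v yv ypv] := near_cell y j yS.
  have cutE i : `|g j i x - g j i y| = 1 - f i u * f i v.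
    rewrite /g /carved !margin1// !mul1r xu yv /=.
    case: (fcut i u) (fcut i v) => -> [] ->;
      rewrite ?subrr ?normr0 ?mulrNN ?mulrN ?mulNr mulr1 ?subrr//.
      by rewrite ger0_norm// opprK.
    by rewrite -opprD normrN ger0_norm// opprK.
  under eq_bigr => i _ do rewrite cutE.
  apply: le_trans (lab u v).
  rewrite /bad (negbTE xgood) (negbTE ygood) addr0 mulr0 subr0 /D ler_wpM2l//.
  have := @dot_lipschitz R n x y (p u) (p v) xS (pS v); rewrite ler_norml => /andP[h _].
  have : n%:R * (`|x - p u| + `|y - p v|) <= n%:R * (4 * e) :> R.
    by rewrite ler_wpM2l//; lra.
  by lra.
have sumgood : N%:R * D - 4 * b * #|V|%:R <= \sum_j \sum_i la i * `|g j i x - g j i y|.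
  apply: (@le_trans _ _ (\sum_j (D - 2 * b * (bad x j + bad y j)))); last first.
    by apply: ler_sum => j _; exact: good.
  rewrite sumrB sum_ord_const lerD2l lerN2.
  rewrite -mulr_sumr big_split /=.
  have := sum_bad x; have := sum_bad y; nra.
rewrite [leRHS]mulrC ler_pdivlMr//; apply: le_trans sumgood.
have eb : 8 * (n%:R * b * e) <= d.
  rewrite /e; set c := n%:R * b in nb0 *.
  rewrite (_ : 8 * (c * _) = d * (c / (c + 1))); last by field; lra.
  by rewrite ger_pMr// ler_pdivrMr; lra.
have : N%:R * (8 * (n%:R * b * e)) <= N%:R * d by rewrite ler_pM2l.
rewrite /D; lra.
Qed.

(** * Averaging over the orthogonal group *)

Section OrbitAveraging.
Variables (R : realType) (n : nat).
Let kernel := 'cV[R]_n -> 'cV[R]_n -> R.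
Implicit Types (K : kernel) (Q : set kernel) (T : 'M[R]_n).

Definition orbit_average (I : finType) (T : I -> 'M[R]_n) K : kernel :=
  fun x y => \sum_i (#|I|%:R)^-1 * K (T i *m x) (T i *m y).

Definition average_closed Q := forall (I : finType) (T : I -> 'M[R]_n) K,
  (0 < #|I|)%N -> (forall i, orthogonal_mx (T i)) -> Q K -> Q (orbit_average T K).

Definition uniformly_closed Q := forall K,
  (forall e, 0 < e -> exists K', Q K' /\
     forall x y, sphere x -> sphere y -> `|K' x y - K x y| <= e) -> Q K.

(** The rotation [T] is built in because the norm is not rotation invariant: with
it, the constant [L] survives averaging over rotations. *)
Definition orbit_lipschitz (L : R) K := forall T x y x' y', orthogonal_mx T ->
  sphere x -> sphere y -> sphere x' -> sphere y' ->
  `|K (T *m x) (T *m y) - K (T *m x') (T *m y')| <= L * (`|x - x'| + `|y - y'|).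

Definition orbit_oscillation (w : R) K := forall T x y, orthogonal_mx T ->
  sphere x -> sphere y -> `|K (T *m x) (T *m y) - K x y| <= w.

Lemma average_le (I : finType) (F : I -> R) (e : R) : (0 < #|I|)%N ->
  (forall i, `|F i| <= e) -> `|\sum_i (#|I|%:R)^-1 * F i| <= e.
Proof.
move=> I0 Fe; have IR : 0 < #|I|%:R :> R by rewrite ltr0n.
rewrite -mulr_sumr normrM gtr0_norm ?invr_gt0// mulrC ler_pdivrMr// mulrC.
by rewrite (le_trans (ler_norm_sum _ _ _))// mulr_natl -sumr_const ler_sum.
Qed.

Lemma averageB (I : finType) (F G : I -> R) :
  \sum_i (#|I|%:R)^-1 * F i - \sum_i (#|I|%:R)^-1 * G i =
  \sum_i (#|I|%:R)^-1 * (F i - G i).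
Proof. by rewrite -sumrB; apply: eq_bigr => i _; rewrite mulrBr. Qed.

Lemma average_const (I : finType) (c : R) : (0 < #|I|)%N ->
  \sum_(i : I) (#|I|%:R)^-1 * c = c.
Proof.
move=> I0; rewrite -mulr_sumr sumr_const -[c *+ _]mulr_natl mulKf//.
by rewrite pnatr_eq0 -lt0n.
Qed.

Lemma orbit_lipschitz_closed L : average_closed (orbit_lipschitz L).
Proof.
move=> I T K I0 TO KL U x y x' y' UO xS yS x'S y'S.
rewrite averageB; apply: average_le => // i; rewrite !mulmxA.
by apply: KL => //; exact: orthogonal_mxM.
Qed.

(** Averaging over an [e]-net of the orthogonal group contracts the oscillation.
The difference of the averages at [T x] and at [x] is a sum of [#|V|]
differences of values of [K] on one orbit, each at most [w]; the net contains
[p v1] close to [p v0 *m T], so permuting the terms makes one of them tiny. *)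
Lemma averaging_step (L e : R) (V : finType) (p : V -> 'M[R]_n) K (w : R) :
  0 <= L -> 0 <= e ->
  (forall v, orthogonal_mx (p v)) ->
  (forall T, orthogonal_mx T -> exists v, forall i j, `|T i j - p v i j| <= e) ->
  orbit_lipschitz L K -> orbit_oscillation w K ->
  (0 < #|V|)%N /\
  orbit_oscillation (w - (w - L * (2 * n%:R * e)) / #|V|%:R) (orbit_average p K).
Proof.
move=> L0 e0 pO net KL Kw.
have [v0 _] := net _ (@orthogonal_mx1 R n).
have V0 : (0 < #|V|)%N by apply/card_gt0P; exists v0.
split=> // T x y TO xS yS.
have VR : 0 < #|V|%:R :> R by rewrite ltr0n.
have [v1 v1P] := net _ (orthogonal_mxM (pO v0) TO).
pose F v := K (p v *m (T *m x)) (p v *m (T *m y)).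
pose G v := K (p v *m x) (p v *m y).
have FG u v : `|F u - G v| <= w.
  have := Kw (p u *m T *m (p v)^T) (p v *m x) (p v *m y).
  rewrite /F /G -!mulmxA !(mulmxA (p v)^T) !pO !mul1mx; apply.
  - by rewrite mulmxA; apply: orthogonal_mxM;
      [exact: orthogonal_mxM|exact: orthogonal_trmx].
  - exact: orthogonal_sphere.
  - exact: orthogonal_sphere.
have FG1 : `|F v0 - G v1| <= L * (2 * n%:R * e).
  have := KL 1%:M (p v0 *m T *m x) (p v0 *m T *m y) (p v1 *m x) (p v1 *m y)
     (@orthogonal_mx1 R n).
  rewrite !mul1mx /F /G !mulmxA => /(_ _ _ _ _)/wrap[||||h].
  1,2: by apply: orthogonal_sphere => //; exact: orthogonal_mxM.
  1,2: by apply: orthogonal_sphere.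
  apply: (le_trans h); rewrite ler_wpM2l// -!mulmxBl.
  have bnd z : sphere z -> `|(p v0 *m T - p v1) *m z| <= n%:R * e.
    move=> zS; rewrite (le_trans (mulmx_norm_le _ e0 _))//.
      by move=> i j; rewrite !mxE; have := v1P i j; rewrite !mxE.
    by rewrite -[leRHS]mulr1 ler_wpM2l ?mulr_ge0// sphere_norm_le1.
  by rewrite (le_trans (lerD (bnd x xS) (bnd y yS)))//; lra.
(* The transposition pairs the term [v0] at [T x] with the term [v1] at [x]. *)
have -> : orbit_average p K (T *m x) (T *m y) - orbit_average p K x y =
    (#|V|%:R)^-1 * \sum_v (F v - G (tperm v0 v1 v)).
  rewrite /orbit_average -!mulr_sumr -mulrBr sumrB; congr (_ * (_ - _)).
  exact: (reindex_inj (@perm_inj _ (tperm v0 v1))).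
rewrite normrM gtr0_norm ?invr_gt0// mulrC ler_pdivrMr//.
apply: (le_trans (ler_norm_sum _ _ _)).
rewrite (bigD1 v0)//= tpermL.
have : \sum_(v | v != v0) `|F v - G (tperm v0 v1 v)| <= (#|V|%:R - 1) * w.
  rewrite (_ : #|V|%:R - 1 = #|predC1 v0|%:R).
    by rewrite mulr_natl -sumr_const; apply: ler_sum.
  by rewrite (cardC1 v0) -subn1 natrB.
move=> h; apply: (le_trans (lerD FG1 h)).
by rewrite [leRHS]mulrBl divfK ?gt_eqF//; lra.
Qed.

(** Each averaging step with a net fine enough for [e] lowers the oscillation by
[w / (4 * #|V|)] as long as it exceeds [w / 2], so that [2 * #|V|] steps
suffice. All kernels obtained are averages of rotations of [K], hence stay
within [w] of it. *)
Lemma oscillation_halving (L w : R) Q K :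
  0 <= L -> 0 < w -> average_closed Q ->
  Q K -> orbit_lipschitz L K -> orbit_oscillation w K ->
  exists K', [/\ Q K', orbit_oscillation (w / 2) K' &
    forall x y, sphere x -> sphere y -> `|K' x y - K x y| <= w].
Proof.
move=> L0 w0 Qavg QK KL Kw.
have [c cE] : exists c, c = L * n%:R by exists (L * n%:R).
have c0 : 0 <= c by rewrite cE mulr_ge0.
pose e := w / (8 * (c + 1)).
have e0 : 0 < e by rewrite divr_gt0// mulr_gt0//; lra.
have ce : L * (2 * n%:R * e) <= w / 4.
  rewrite (_ : L * _ = 2 * c * e); last by rewrite cE; ring.
  rewrite (_ : 2 * c * e = w / 4 * (c / (c + 1))); last by rewrite /e; field; lra.
  by rewrite ger_pMr ?divr_gt0// ler_pdivrMr; lra.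
have [|V [p [pO net]]] := @bounded_net R n n (@orthogonal_mx R n) e e0.
  by move=> T TO i j; exact: orthogonal_entry_le1.
pose P K' := [/\ Q K', orbit_lipschitz L K' & forall T x y, orthogonal_mx T ->
  sphere x -> sphere y -> `|K' x y - K (T *m x) (T *m y)| <= w].
have step K' w' : P K' -> orbit_oscillation w' K' -> w / 2 <= w' ->
    (0 < #|V|)%N /\ exists K'', P K'' /\
    orbit_oscillation (w' - w / 4 / #|V|%:R) K''.
  move=> [QK' K'L K'K] K'w ww'.
  have [V0 osc] := averaging_step L0 (ltW e0) pO net K'L K'w.
  have VR : 0 < #|V|%:R :> R by rewrite ltr0n.
  split=> //; exists (orbit_average p K'); split; last first.
    move=> T x y TO xS yS; apply: (le_trans (osc T x y TO xS yS)).
    by rewrite lerD2l lerN2 ler_pM2r ?invr_gt0//; lra.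
  split; [exact: Qavg|exact: orbit_lipschitz_closed|].
  move=> T x y TO xS yS; rewrite -[K (T *m x) _](average_const _ V0) averageB.
  apply: average_le => // v.
  have := K'K (T *m (p v)^T) (p v *m x) (p v *m y).
  rewrite -!mulmxA !(mulmxA (p v)^T) !pO !mul1mx; apply.
  - by apply: orthogonal_mxM => //; exact: orthogonal_trmx.
  - exact: orthogonal_sphere.
  - exact: orthogonal_sphere.
have iterate k : forall K', P K' -> (0 < #|V|)%N ->
    orbit_oscillation (w / 2 + k%:R * (w / 4 / #|V|%:R)) K' ->
    exists K'', P K'' /\ orbit_oscillation (w / 2) K''.
  elim: k => [|k IH] K' PK' V0 K'w.
    by exists K'; split => //; rewrite mul0r addr0 in K'w.
  have VR : 0 < #|V|%:R :> R by rewrite ltr0n.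
  have [|_ [K'' [PK'' K''w]]] := step K' _ PK' K'w.
    by rewrite lerDl mulr_ge0// divr_ge0// ltW// divr_gt0.
  apply: (IH K'' PK'' V0) => T x y TO xS yS.
  apply: (le_trans (K''w T x y TO xS yS)).
  by rewrite -[k.+1]addn1 natrD [(_ + 1) * _]mulrDl mul1r; lra.
have PK : P K by split=> // T x y TO xS yS; rewrite distrC; exact: Kw.
have [|V0 _] := step K w PK Kw; first by lra.
have VR : 0 < #|V|%:R :> R by rewrite ltr0n.
have [|K' [[QK' _ K'K] K'w]] := iterate (#|V| * 2)%N K PK V0.
  move=> T x y TO xS yS; apply: (le_trans (Kw T x y TO xS yS)).
  rewrite natrM (_ : _ + _ = w)//; field; exact: lt0r_neq0.
exists K'; split=> // x y xS yS.
by have := K'K 1%:M x y (@orthogonal_mx1 R n) xS yS; rewrite !mul1mx.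
Qed.

(** Halving the oscillation repeatedly gives a sequence that converges uniformly
on the sphere, at a geometric rate; its limit has no oscillation. This replaces
integration against the Haar measure. *)
Lemma invariant_kernel_exists (L w : R) Q K :
  0 <= L -> 0 < w -> average_closed Q -> uniformly_closed Q ->
  (forall K', Q K' -> orbit_lipschitz L K') ->
  Q K -> orbit_oscillation w K ->
  exists K', Q K' /\ invariant_kernel K'.
Proof.
move=> L0 w0 Qavg Qclosed QL QK Kw.
pose X := {z : kernel * R | [/\ Q z.1, 0 < z.2 & orbit_oscillation z.2 z.1]}.
have step (z : X) : {z' : X | (sval z').2 = (sval z).2 / 2 /\
    forall x y, sphere x -> sphere y ->
    `|(sval z').1 x y - (sval z).1 x y| <= (sval z).2}.
  case: z => -[K1 w1] /= [QK1 w10 K1w]; apply: cid.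
  have [K2 [QK2 K2w K2K]] :=
    oscillation_halving L0 w10 Qavg QK1 (QL _ QK1) K1w.
  have PK2 : [/\ Q (K2, w1 / 2).1, 0 < (K2, w1 / 2).2 &
    orbit_oscillation (K2, w1 / 2).2 (K2, w1 / 2).1] by split=> //=; lra.
  by exists (exist _ (K2, w1 / 2) PK2).
have PK : [/\ Q (K, w).1, 0 < (K, w).2 & orbit_oscillation (K, w).2 (K, w).1].
  by [].
have [F [F0 FS]] := dependent_choice step (exist _ (K, w) PK).
pose Kn k := (sval (F k)).1; pose wn k := (sval (F k)).2.
have QKn k : Q (Kn k) by rewrite /Kn; case: (F k) => -[? ?] [].
have Knw k : orbit_oscillation (wn k) (Kn k).
  by rewrite /Kn /wn; case: (F k) => -[? ?] [].
have wnS k : wn k.+1 = wn k / 2 by have [] := FS k.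
have KnS k x y : sphere x -> sphere y -> `|Kn k.+1 x y - Kn k x y| <= wn k.
  by have [_] := FS k; apply.
have wn0 k : 0 < wn k by rewrite /wn; case: (F k) => -[? ?] [].
have wn_small e : 0 < e -> exists k, wn k <= e.
  move=> e0; exists (Num.truncn (w / e)).+1.
  have wnle k : wn k * k%:R <= w.
    have : wn k * k.+1%:R <= w.
      elim: k => [|k IH]; first by rewrite mulr1 /wn F0.
      apply: le_trans IH; rewrite wnS -[k.+2]addn1 -[k.+1]addn1 !natrD.
      have := wn0 k; have : 0 <= k%:R :> R by []. nra.
    apply: le_trans; rewrite ler_wpM2l ?ler_nat// ltW//.
  have := wnle (Num.truncn (w / e)).+1; have := truncnS_gt (w / e).
  rewrite ltr_pdivrMr//; set N := _.+1%:R => h1 h2.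
  have N0 : 0 < N by rewrite ltr0n.
  by rewrite -(ler_pM2r N0) (le_trans h2)// mulrC ltW// mulrC.
(* The intervals of centre [Kn k x y] and radius [2 * wn k] are nested. *)
pose Kinf x y := sup (range (fun k => Kn k x y - 2 * wn k)).
have Kn_close k x y : sphere x -> sphere y -> `|Kn k x y - Kinf x y| <= 2 * wn k.
  move=> xS yS.
  have nested i d : Kn i x y - 2 * wn i <= Kn (i + d)%N x y - 2 * wn (i + d)%N /\
      Kn (i + d)%N x y + 2 * wn (i + d)%N <= Kn i x y + 2 * wn i.
    elim: d => [|d [IH1 IH2]]; first by rewrite addn0.
    rewrite addnS wnS; have := KnS (i + d)%N x y xS yS.
    by rewrite ler_norml => /andP[? ?]; split; lra.
  have ub i j : Kn i x y - 2 * wn i <= Kn j x y + 2 * wn j.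
    have [h1 _] := nested i (maxn i j - i)%N; have [_ h2] := nested j (maxn i j - j)%N.
    move: h1 h2; rewrite !subnKC ?leq_maxl ?leq_maxr// => h1 h2.
    have := wn0 (maxn i j); lra.
  have ubk : ubound (range (fun k => Kn k x y - 2 * wn k)) (Kn k x y + 2 * wn k).
    by move=> _ [i _ <-]; exact: ub.
  have h1 : Kn k x y - 2 * wn k <= Kinf x y.
    by apply: ub_le_sup; [exists (Kn k x y + 2 * wn k)|exists k].
  have h2 : Kinf x y <= Kn k x y + 2 * wn k.
    by apply: ge_sup => //; exists (Kn 0%N x y - 2 * wn 0%N), 0%N.
  by rewrite ler_norml; apply/andP; split; lra.
exists Kinf; split.
  apply: Qclosed => e e0; have [|k ke] := wn_small (e / 2); first by lra.
  exists (Kn k); split=> // x y xS yS.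
  by apply: (le_trans (Kn_close k x y xS yS)); lra.
move=> T TO x y xS yS; apply/eqP; rewrite -subr_eq0 -normr_le0.
apply/ler_addgt0Pr => e e0; have [|k ke] := wn_small (e / 5); first by lra.
have TxS := orthogonal_sphere TO xS; have TyS := orthogonal_sphere TO yS.
have := Kn_close k _ _ xS yS; have := Kn_close k _ _ TxS TyS.
have := Knw k T x y TO xS yS.
rewrite !ler_norml => /andP[? ?] /andP[? ?] /andP[? ?].
by apply/andP; split; lra.
Qed.
End OrbitAveraging.

(** * Semidefinite values and duality with the gap *)

Section IntegralityGap.
Variables (R : realType).

Definition sdp_value (n : nat) (V : finType) (A : V -> V -> R)
    (f : V -> 'cV[R]_n) : R := \sum_x \sum_y A x y * (1 - dot (f x) (f y)).

Lemma le_SDP n (V : finType) (A : V -> V -> R) (f : V -> 'cV[R]_n) :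
  (forall x y, 0 <= A x y) -> (forall x, sphere (f x)) ->
  sdp_value A f <= SDP n A.
Proof.
move=> A0 fS; apply: ub_le_sup; last by exists f.
exists (\sum_x \sum_y A x y * 2) => _ [g [gS ->]].
apply: ler_sum => x _; apply: ler_sum => y _; rewrite ler_wpM2l//.
by have /andP[] := sphere_dot_itv (gS x) (gS y); lra.
Qed.

Lemma SDP_le n (V : finType) (A : V -> V -> R) (m : R) (x0 : 'cV[R]_n) :
  sphere x0 ->
  (forall f : V -> 'cV[R]_n, (forall x, sphere (f x)) -> sdp_value A f <= m) ->
  SDP n A <= m.
Proof.
move=> x0S fm; apply: ge_sup; first by exists (sdp_value A (fun=> x0)), (fun=> x0).
by move=> _ [f [fS ->]]; exact: fm.
Qed.

Lemma SDP_ge0 n (V : finType) (A : V -> V -> R) (x0 : 'cV[R]_n) :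
  (forall x y, 0 <= A x y) -> sphere x0 -> 0 <= SDP n A.
Proof.
move=> A0 x0S; apply: le_trans (le_SDP (f := fun=> x0) A0 _) => //.
rewrite /sdp_value big1 // => x _; rewrite big1// => y _.
by rewrite (_ : dot x0 x0 = 1)// subrr mulr0.
Qed.

Lemma dot1E (x y : 'cV[R]_1) : dot x y = x 0 0 * y 0 0.
Proof. by rewrite /dot big_ord1. Qed.

Lemma sphere_const1 (c : R) : c = 1 \/ c = -1 -> sphere (const_mx c : 'cV[R]_1).
Proof.
by rewrite /sphere /= dot1E !mxE => -[] ->; rewrite ?mulrNN mulr1.
Qed.

Lemma le_SDP1 (V : finType) (A : V -> V -> R) (f : V -> R) :
  (forall x y, 0 <= A x y) -> is_cut f ->
  \sum_x \sum_y A x y * (1 - f x * f y) <= SDP 1 A.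
Proof.
move=> A0 fcut.
apply: le_trans (le_SDP (f := fun x => const_mx (f x) : 'cV[R]_1) A0 _).
  by apply: ler_sum => x _; apply: ler_sum => y _; rewrite dot1E !mxE.
by move=> x; apply: sphere_const1; exact: fcut.
Qed.

Lemma SDP1_le (V : finType) (A : V -> V -> R) (m : R) :
  (forall f, is_cut f -> \sum_x \sum_y A x y * (1 - f x * f y) <= m) ->
  SDP 1 A <= m.
Proof.
move=> fm; apply: (@SDP_le _ _ _ _ (const_mx 1)).
  by apply: sphere_const1; left.
move=> f fS; apply: le_trans (fm (fun x => f x 0 0) _).
  by apply: ler_sum => x _; apply: ler_sum => y _; rewrite dot1E.
move=> x; have := fS x; rewrite /sphere /= dot1E -expr2 => /eqP.
by rewrite sqrf_eq1 => /orP[]/eqP; [left|right].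
Qed.

(** Linear programming duality. If no convex combination of cuts dominated
[b * (1 - p u . p v)], the alternative would give nonnegative weights [A] for
which every cut is worth less than [b] times the value of [p], contradicting
the bound on the gap. *)
Lemma cut_dominates (n : nat) (b : R) : 0 <= b ->
  (forall (V : finType) (A : V -> V -> R), (0 < #|V|)%N ->
     (forall x y, 0 <= A x y) -> SDP 1 A != 0 -> b * SDP n A <= SDP 1 A) ->
  forall (V : finType) (p : V -> 'cV[R]_n), (forall v, sphere (p v)) ->
  exists (J : finType) (la : J -> R) (f : J -> V -> R),
    [/\ forall j, 0 <= la j, \sum_j la j = 1, forall j, is_cut (f j)
      & forall u v, b * (1 - dot (p u) (p v)) <=
                    \sum_j la j * (1 - f j u * f j v)].
Proof.
move=> b0 gap V p pS.
pose f (j : {ffun V -> bool}) (u : V) : R := if j u then 1 else -1.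
have fcut j : is_cut (f j) by move=> u; rewrite /f; case: ifP; [left|right].
pose B j (uv : V * V) :=
  (1 - f j uv.1 * f j uv.2) - b * (1 - dot (p uv.1) (p uv.2)).
have [[la [la0 la1 laB]]|[A' [A'0 A'B]]] := matrix_alternative B.
  exists {ffun V -> bool}, la, f; split=> // u v.
  have := laB (u, v); under eq_bigr => j _ do rewrite /B /= mulrBr.
  by rewrite sumrB -mulr_suml la1 mul1r subr_ge0.
exfalso.
pose A u v := A' (u, v).
have A0 u v : 0 <= A u v by exact: A'0.
pose S j := \sum_u \sum_v A u v * (1 - f j u * f j v).
pose T := sdp_value A p.
have SbT j : S j < b * T.
  rewrite -subr_lt0; apply: le_lt_trans (A'B j).
  have -> : \sum_uv A' uv * B j uv = \sum_u \sum_v A u v * B j (u, v).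
    by rewrite pair_bigA; apply: eq_bigr => -[].
  rewrite /S /T /sdp_value mulr_sumr -sumrB; apply: ler_sum => u _.
  rewrite mulr_sumr -sumrB; apply: ler_sum => v _.
  by rewrite /B /=; lra.
have S0 j : 0 <= S j.
  apply: sumr_ge0 => u _; apply: sumr_ge0 => v _; rewrite mulr_ge0//.
  by case: (fcut j u) (fcut j v) => -> [] ->; lra.
have [j0 _ jmax] := @arg_maxP _ _ _ [ffun=> true] xpredT S isT.
have SDP1S : SDP 1 A <= S j0.
  by apply: SDP1_le => g /is_cutP[j ->]; exact: jmax.
have V0 : (0 < #|V|)%N.
  rewrite lt0n; apply/eqP => /card0_eq Vempty.
  have := SbT j0; rewrite /S /T /sdp_value !big1 ?mulr0 ?ltxx// => u.
    by have := Vempty u; rewrite inE.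
  by have := Vempty u; rewrite inE.
have bT : b * T <= b * SDP n A by rewrite ler_wpM2l// le_SDP.
(* When all cuts have value 0, the off-diagonal weights vanish, by the cuts
   that isolate one point, and then so does the value of [p]. *)
have [SDP10|SDP10] := eqVneq (SDP 1 A) 0; last first.
  by have := gap V A V0 A0 SDP10; have := SbT j0; lra.
have T0 : T <= 0.
  apply: sumr_le0 => u _; apply: sumr_le0 => v _.
  have [<-|uv] := eqVneq u v; first by rewrite (pS u) subrr mulr0.
  have Auv : A u v <= 0.
    pose j := [ffun x => x == u].
    have : S j <= 0 by rewrite -SDP10; exact: le_SDP1.
    rewrite /S (bigD1 u)//= (bigD1 v)//= {1 2}/f !ffunE eqxx eq_sym (negbTE uv).
    set X := \sum_(i | i != v) _; set Y := \sum_(i | i != u) _.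
    have pos x y : 0 <= A x y * (1 - f j x * f j y).
      by rewrite mulr_ge0//; case: (fcut j x) (fcut j y) => -> [] ->; lra.
    have X0 : 0 <= X by apply: sumr_ge0.
    have Y0 : 0 <= Y by apply: sumr_ge0 => x _; apply: sumr_ge0.
    by lra.
  have /andP[_ d1] := sphere_dot_itv (pS u) (pS v).
  by rewrite mulr_le0_ge0// subr_ge0.
have := SbT j0; have := S0 j0; nra.
Qed.

End IntegralityGap.

(** * Invariant kernels on the sphere and the optimal value *)

Section SphereKernels.
Variables (R : realType) (n : nat).
Implicit Types (K : 'cV[R]_n -> 'cV[R]_n -> R).

Lemma cut_sphere_kernel K : cut_sphere K -> cut_kernel (@sphere R n) K.
Proof.
move=> [_ Kcut] V p c m pS cm.
have [V0|] := eqVneq #|V| 0%N.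
  apply: le_trans (cm (fun=> 1) (fun=> or_introl erefl)).
  by rewrite !big1// => u; have := card0_eq V0 u; rewrite inE.
rewrite -lt0n => /card_gt0P[v0 _].
pose U := [fset x in [seq p v | v <- enum V]]%fset.
have pU v : p v \in U by rewrite !inE /= map_f ?mem_enum.
have US : [set` U] `<=` @sphere R n.
  by move=> x /=; rewrite !inE /= => /mapP[v _ ->]; exact: pS.
have U0 : U != fset0 by apply/fset0Pn; exists (p v0).
have /cut_polytopeP UK := Kcut U U0 US.
by have := UK V (fun v => FSetSub (pU v)) c m (fun=> I) cm.
Qed.

Lemma cut_kernel_sphere K L :
  cut_kernel (@sphere R n) K -> orbit_lipschitz L K -> 0 <= L -> cut_sphere K.
Proof.
move=> Kcut KL L0; split; last first.
  move=> U _ US; apply/cut_polytopeP => V p c m _ cm.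
  by apply: (Kcut V (fun v => val (p v))) => // v; apply: US; exact: valP.
apply/subspace_continuousP => -[x y] [/= xS yS]; apply/cvgrPdist_le => e e0.
rewrite near_withinE.
have d0 : 0 < e / (2 * (L + 1)) by rewrite divr_gt0// mulr_gt0//; lra.
near=> z => -[zS1 zS2].
have : ball (x, y) (e / (2 * (L + 1))) z by near: z; exact: nbhsx_ballx.
move=> [/=]; rewrite -!ball_normE /= => /ltW h1 /ltW h2.
have := KL 1%:M x y z.1 z.2 (@orthogonal_mx1 R n) xS yS zS1 zS2.
rewrite !mul1mx => h; apply: (le_trans h).
have -> : e = (L + 1) * (e / (2 * (L + 1)) + e / (2 * (L + 1))) by field; lra.
by apply: ler_pM; rewrite ?addr_ge0 ?lerD// lerDl.
Unshelve. all: by end_near. Qed.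

(** Pairs of unit vectors with the same inner product form a single orbit, so the
value picked by [kernel_at] is the value at any such pair. *)
Lemma kernel_atE K x y : invariant_kernel K -> sphere x -> sphere y ->
  kernel_at K (dot x y) = K x y.
Proof.
move=> Kinv xS yS; rewrite /kernel_at.
set P := (X in get X); have [|x' [y' [x'S y'S xy ->]]] := @getPex _ P.
  by exists (K x y), x, y.
have [T [TO <- <-]] := orthogonal_pair_transitive x'S y'S xS yS xy.
by rewrite Kinv.
Qed.

(** Where [1 - dot x y >= 1 / 2], the slack [(b - a) / 2] is absorbed by lowering
[b] to [a]. Closer pairs are treated by reflecting [x] in the line of [y]: for
[z = 2 t y - x], [t = dot x y], invariance gives [K y z = K x y], the triangle
inequality gives [1 - K x z <= 2 (1 - K x y)], and
[1 - dot x z = 2 (1 - t) (1 + t)] is at least [2 (1 - t)]. So the bound at the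
more distant pair [x], [z] implies the one at [x], [y]. *)
Lemma invariant_bound_doubling K (a b : R) :
  cut_kernel (@sphere R n) K -> invariant_kernel K -> 0 <= b -> a < b ->
  (forall x y, sphere x -> sphere y ->
     b * (1 - dot x y) - (b - a) / 2 <= 1 - K x y) ->
  forall x y, sphere x -> sphere y -> a * (1 - dot x y) <= 1 - K x y.
Proof.
move=> Kcut Kinv b0 ab Kb.
have K1 x y : sphere x -> sphere y -> 0 <= 1 - K x y.
  by move=> xS yS; rewrite subr_ge0; exact: cut_kernel_le1 Kcut xS yS.
have [a0|a0] := ltP a 0.
  move=> x y xS yS; apply: le_trans (K1 x y xS yS).
  have /andP[_ ?] := sphere_dot_itv xS yS; nra.
have main k x y : sphere x -> sphere y ->
    1 / 2 <= k.+1%:R * (1 - dot x y) -> a * (1 - dot x y) <= 1 - K x y.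
  elim: k x y => [|k IH] x y xS yS hk.
    by apply: le_trans (Kb x y xS yS); rewrite mul1r in hk; nra.
  have [t1|t1] := leP (1 / 2) (1 - dot x y).
    by apply: le_trans (Kb x y xS yS); nra.
  have xyx : dot y x = dot x y by exact: dotC.
  set t := dot x y in hk t1 xyx *.
  have /andP[_ t2] : -1 <= t <= 1 by exact: sphere_dot_itv.
  pose z := (2 * t) *: y - x.
  have yz : dot y z = t by rewrite dotBr dotZr yS xyx; ring.
  have xz : dot x z = 2 * t ^+ 2 - 1 by rewrite dotBr dotZr xS -/t; ring.
  have zS : sphere z.
    by rewrite /sphere /= dotBl dotZl yz xz; ring.
  have [T [TO Tx Ty]] := orthogonal_pair_transitive xS yS yS zS (esym yz).
  have Kyz : K y z = K x y by rewrite -{1}Tx -Ty Kinv.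
  have tri := cut_kernel_triangle Kcut xS yS zS; rewrite Kyz in tri.
  have := IH x z xS zS; rewrite xz => /(_ _)/wrap[|h].
    have k0 : 0 <= k.+1%:R :> R by [].
    rewrite -[k.+2]addn1 natrD in hk.
    have k1 : 1 <= k.+1%:R :> R by rewrite ler1n.
    nra.
  have : 0 <= a * (1 - t) * t by rewrite !mulr_ge0//; lra.
  nra.
move=> x y xS yS; have [d0|d0] := leP (1 - dot x y) 0.
  by apply: le_trans (K1 x y xS yS); nra.
apply: (main (Num.truncn (1 / 2 / (1 - dot x y)))) => //.
by rewrite -ler_pdivrMr// ltW// truncnS_gt.
Qed.
End SphereKernels.

Section Optimum.
Variables (R : realType) (n : nat).
Hypothesis n2 : (2 <= n)%N.

Let feasible (a : R) := exists K : 'cV[R]_n -> 'cV[R]_n -> R,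
  [/\ cut_sphere K, invariant_kernel K
    & forall t : R, -1 <= t <= 1 -> 1 - kernel_at K t >= a * (1 - t)].

Lemma sphere_nonempty : exists x : 'cV[R]_n, sphere x.
Proof.
by have [|x [_ [xS _ _]]] := @sphere_pair_exists R n 0 n2; [lra|exists x].
Qed.

(** At the points [f x], [K] lies in the cut polytope, so the value of [f], scaled
by [a], is at most the best value of a cut. *)
Lemma feasible_gap (a : R) : 0 <= a -> feasible a ->
  forall (V : finType) (A : V -> V -> R), (forall x y, 0 <= A x y) ->
  a * SDP n A <= SDP 1 A.
Proof.
move=> a0 [K [/cut_sphere_kernel Kcut Kinv Ka]] V A A0.
have [x0 x0S] := sphere_nonempty.
have key (f : V -> 'cV[R]_n) : (forall x, sphere (f x)) ->
    a * sdp_value A f <= SDP 1 A.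
  move=> fS.
  have := Kcut V f (fun u v => - A u v) (SDP 1 A - \sum_u \sum_v A u v) fS.
  have split1 (F : V -> V -> R) : \sum_u \sum_v - A u v * F u v =
      \sum_u \sum_v A u v * (1 - F u v) - \sum_u \sum_v A u v.
    rewrite -sumrB; apply: eq_bigr => u _; rewrite -sumrB; apply: eq_bigr => v _.
    by ring.
  rewrite (split1 (fun u v => K (f u) (f v))) lerD2r => /(_ _)/wrap[g gcut|h].
    by rewrite (split1 (fun u v => g u * g v)) lerD2r le_SDP1.
  apply: le_trans h; rewrite /sdp_value mulr_sumr; apply: ler_sum => u _.
  rewrite mulr_sumr; apply: ler_sum => v _; rewrite mulrCA ler_wpM2l//.
  by rewrite -(kernel_atE Kinv (fS u) (fS v)) Ka// sphere_dot_itv.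
have [->|ane0] := eqVneq a 0.
  rewrite mul0r; apply: (@SDP_ge0 _ _ _ _ (const_mx 1)) => //.
  by apply: sphere_const1; left.
have {a0 ane0} a0 : 0 < a by rewrite lt_def ane0.
rewrite mulrC -ler_pdivlMr//; apply: (SDP_le x0S) => f fS.
by rewrite ler_pdivlMr// mulrC key.
Qed.

(** The kernel given by rounding is made invariant by averaging; the class [Q]
collects what averaging preserves. *)
Lemma gap_feasible (a b : R) : 0 <= b -> a < b ->
  (forall (V : finType) (A : V -> V -> R), (0 < #|V|)%N ->
     (forall x y, 0 <= A x y) -> SDP 1 A != 0 -> b * SDP n A <= SDP 1 A) ->
  feasible a.
Proof.
move=> b0 ab gap.
have d0 : 0 < (b - a) / 2 by lra.
have [K0 [L [L0 K0cut K0L K0b]]] :=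
  rounded_kernel b0 d0 (cut_dominates b0 gap).
pose Q K := [/\ cut_kernel (@sphere R n) K, orbit_lipschitz (n%:R * L) K &
  forall x y, sphere x -> sphere y -> b * (1 - dot x y) - (b - a) / 2 <= 1 - K x y].
have nL0 : 0 <= n%:R * L by rewrite mulr_ge0.
have QK0 : Q K0.
  split=> // T x y x' y' TO xS yS x'S y'S; apply: (le_trans (K0L _ _ _ _)).
  rewrite -!mulmxBr -mulrA mulrCA ler_wpM2l// mulrDr.
  have TT i j : `|T i j| <= 1 by exact: orthogonal_entry_le1.
  by rewrite lerD// (le_trans (mulmx_norm_le _ ler01 TT))// mulr1.
have Qavg : average_closed Q.
  move=> I T K I0 TO [Kcut KL Kb]; split.
  - apply: cut_kernel_avg => [i||i].
    + by rewrite invr_ge0.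
    + by rewrite -[RHS](average_const 1 I0); apply: eq_bigr => i _; rewrite mulr1.
    + by apply: cut_kernel_comp Kcut => x; exact: orthogonal_sphere.
  - exact: orbit_lipschitz_closed.
  - move=> x y xS yS; rewrite -[1 in leRHS](average_const 1 I0) averageB.
    rewrite -[leLHS](average_const _ I0); apply: ler_sum => i _.
    rewrite ler_wpM2l ?invr_ge0// -(orthogonal_dot x y (TO i)).
    by apply: Kb; exact: orthogonal_sphere.
have Qclosed : uniformly_closed Q.
  move=> K Kapp; split.
  - by apply: cut_kernel_approx => e /Kapp[K' [[K'cut _ _] K'K]]; exists K'.
  - move=> T x y x' y' TO xS yS x'S y'S; apply/ler_addgt0Pr => e e0.
    have [|K' [[_ K'L _] K'K]] := Kapp (e / 2); first by lra.
    have h := K'L T x y x' y' TO xS yS x'S y'S.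
    have TS z : sphere z -> sphere (T *m z) by exact: orthogonal_sphere.
    have := K'K _ _ (TS x xS) (TS y yS); have := K'K _ _ (TS x' x'S) (TS y' y'S).
    move: h; rewrite !ler_norml => /andP[? ?] /andP[? ?] /andP[? ?].
    by apply/andP; split; lra.
  - move=> x y xS yS; apply/ler_addgt0Pr => e e0.
    have [K' [[_ _ K'b] K'K]] := Kapp e e0.
    have := K'b x y xS yS; have := K'K x y xS yS.
    by rewrite ler_norml => /andP[? ?]; lra.
have osc0 : exists2 w : R, 0 < w & orbit_oscillation w K0.
  exists (n%:R * L * (2 * 2) + 1); first by rewrite ltr_wpDl// mulr_ge0.
  move=> T x y TO xS yS; have [_ K0orb _] := QK0.
  have := K0orb 1%:M (T *m x) (T *m y) x y (@orthogonal_mx1 R n).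
  rewrite !mul1mx => /(_ _ _ _ _)/wrap[||||h] //.
  1,2: exact: orthogonal_sphere.
  rewrite (le_trans h)// ler_wpDr// ler_wpM2l//.
  have bnd z : sphere z -> `|T *m z - z| <= 2.
    move=> zS; rewrite (le_trans (ler_normB _ _))//.
    have := sphere_norm_le1 zS; have := sphere_norm_le1 (orthogonal_sphere TO zS).
    by lra.
  by have := bnd x xS; have := bnd y yS; lra.
have [w w0 K0w] := osc0.
have [K [[Kcut KL Kb] Kinv]] := invariant_kernel_exists nL0 w0 Qavg Qclosed
  (fun K' => fun QK' : Q K' => let: And3 _ h _ := QK' in h) QK0 K0w.
exists K; split=> // [|t t1].
  exact: (cut_kernel_sphere Kcut KL nL0).
have [x [y [xS yS <-]]] := sphere_pair_exists n2 t1.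
rewrite kernel_atE//; exact: (invariant_bound_doubling Kcut Kinv b0 ab Kb).
Qed.
End Optimum.

Lemma gamma_ge0 (R : realType) (n : nat) : (2 <= n)%N -> (0 <= gamma R n)%E.
Proof.
move=> n2; have [x0 x0S] := @sphere_nonempty R n n2.
pose A (x y : bool) : R := ((x, y) == (true, false))%:R.
have A0 x y : 0 <= A x y by [].
have S1 : 0 < SDP 1 A.
  apply: lt_le_trans (le_SDP1 (f := fun b : bool => if b then 1 else -1) A0 _).
    rewrite (sum_delta _ (fun x y =>
      1 - (if x then 1 else -1) * (if y then 1 else -1))) /=.
    by lra.
  by move=> b; case: b; [left|right].
apply: (@le_trans _ _ (SDP n A / SDP 1 A)%:E).
  by rewrite lee_fin divr_ge0// ?(ltW S1)// (SDP_ge0 A0 x0S).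
apply: ereal_sup_ubound; exists bool, A.
by rewrite card_bool gt_eqF.
Qed.

Lemma ereal_dense (R : realFieldType) (x y : \bar R) : (x < y)%E ->
  exists c : R, (x < c%:E)%E /\ (c%:E < y)%E.
Proof.
case: x y => [r| |] [s| |] //= xy.
- by exists ((r + s) / 2); move: xy; rewrite !lte_fin; split; lra.
- by exists (r + 1); rewrite lte_fin ltry; split => //; lra.
- by exists (s - 1); rewrite lte_fin ltNyr; split => //; lra.
- by exists 0; rewrite ltNyr ltry.
Qed.

Theorem theorem1p1 (R : realType) (n : nat) (hn : (2 <= n)%N) :
  alpha R n =
  ereal_sup [set a%:E | a in [set a : R |
    exists K : 'cV[R]_n -> 'cV[R]_n -> R,
      [/\ cut_sphere K, invariant_kernel K
        & forall t : R, -1 <= t <= 1 -> 1 - kernel_at K t >= a * (1 - t)]]].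
Proof.
have g0 := gamma_ge0 R hn.
have SDP1_ge0 (V : finType) (A : V -> V -> R) :
    (forall x y, 0 <= A x y) -> 0 <= SDP 1 A.
  by move=> A0; apply: (SDP_ge0 A0 (sphere_const1 (or_introl erefl))).
apply/eqP; rewrite eq_le; apply/andP; split; last first.
  apply: ge_ereal_sup => _ [a feas <-]; rewrite /alpha.
  have [a0|a0] := leP a 0.
    by apply: (@le_trans _ _ 0%E); rewrite ?lee_fin// inve_ge0.
  rewrite inve_pge ?inE ?lee_fin ?(ltW a0)// inver (gt_eqF a0).
  apply: ge_ereal_sup => _ [V [A [V0 A0 S1 ->]]].
  have S1pos : 0 < SDP 1 A by rewrite lt_def S1 SDP1_ge0.
  rewrite lee_fin ler_pdivrMr// mulrC ler_pdivlMr// mulrC.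
  exact: (feasible_gap hn (ltW a0) feas).
rewrite leNgt; apply/negP => lt_alpha.
have [c [supc calpha]] := ereal_dense lt_alpha.
suff [K Kfeas] : exists K : 'cV[R]_n -> 'cV[R]_n -> R,
    [/\ cut_sphere K, invariant_kernel K
      & forall t : R, -1 <= t <= 1 -> 1 - kernel_at K t >= c * (1 - t)].
  move: supc; apply/negP; rewrite -leNgt; apply: ereal_sup_ubound.
  by exists c => //; exists K.
have [c0|c0] := ltP c 0.
  by apply: (gap_feasible hn (lexx 0) c0) => V A _ A0 _; rewrite mul0r SDP1_ge0.
have [b [+ balpha]] := ereal_dense calpha; rewrite lte_fin => cb.
have b0 : 0 < b by exact: le_lt_trans cb.
apply: (gap_feasible hn (ltW b0) cb) => V A V0 A0 S1.
have S1pos : 0 < SDP 1 A by rewrite lt_def S1 SDP1_ge0.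
have : (gamma R n < (b^-1)%:E)%E.
  move: balpha; rewrite /alpha inve_pgt ?inE ?lee_fin ?(ltW b0)//.
  by rewrite inver (gt_eqF b0).
have : ((SDP n A / SDP 1 A)%:E <= gamma R n)%E.
  by apply: ereal_sup_ubound; exists V, A.
move=> /le_lt_trans/[apply]; rewrite lte_fin ltr_pdivrMr// => h.
by rewrite -ler_pdivlMl// ltW.
Qed.
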